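(* Let $(W,S)$ be a finite Coxeter group, let $p$ be a prime, let $\Sigma(W,p)$ be the $p$-modular descent algebra of $W$ and let $\phi:\Sigma(W,p)\to G(W,p)$ be the algebra homomorphism with $\phi(\overline{x}_K)=\chi_K \bmod p$ for all $K\subseteq S$. Then $\mathrm{rad}(\Sigma(W,p))=\ker\phi$. Moreover, $\mathrm{rad}(\Sigma(W,p))$ is spanned by all $\overline{x}_J-\overline{x}_K$ where $J,K$ are conjugate subsets of $S$, together with all $\overline{x}_J$, $J\subseteq S$, for which $p$ divides $[N_W(W_J):W_J]$.
   Context: $(W,S)$ is a finite Coxeter group with set $S$ of fundamental reflections. For $L\subseteq S$, $W_L$ is the subgroup generated by $L$, $X_L$ is the set of minimal length representatives of the left cosets $wW_L$ of $W_L$ in $W$, and $x_L=\sum_{w\in X_L}w\in\mathbb{Q}W$. Solomon's theorem: the $x_L$ ($L\subseteq S$) form a basis of a subalgebra $\Sigma_W$ of $\mathbb{Q}W$ (the descent algebra), and $x_Jx_K=\sum_L a_{JKL}x_L$ with integers $a_{JKL}$. Hence the $\mathbb{Z}$-span $\mathcal{Z}_W$ of the $x_L$ is a subring, and for a prime $p$ one sets $\Sigma(W,p)=\mathcal{Z}_W/p\mathcal{Z}_W$, an algebra over the field $\mathbb{F}_p$; $\rho_1:\mathcal{Z}_W\to\Sigma(W,p)$ is the projection and $\overline{x}_L=\rho_1(x_L)$. Let $\chi_K$ be the permutation character of $W$ on the cosets of $W_K$, and $G_W$ the $\mathbb{Z}$-module generated by all $\chi_K$, $K\subseteq S$ (a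 ring of integer-valued functions on $W$). The linear map $\theta$ with $\theta(x_K)=\chi_K$ is an algebra homomorphism (Solomon). Let $\rho_2$ be the map on $G_W$ reducing values modulo $p$, and $G(W,p)=\rho_2(G_W)$, an $\mathbb{F}_p$-algebra of functions $W\to\mathbb{F}_p$. The map $\phi$ is defined by $\phi(\rho_1(x))=\rho_2(\theta(x))$ for $x\in\mathcal{Z}_W$; it is a well-defined algebra homomorphism. $\mathrm{rad}$ denotes the (Jacobson) radical. Subsets $J,K\subseteq S$ are conjugate if $w^{-1}Jw=K$ for some $w\in W$. *)

(* Defs.v *)
Set Warnings "-notation-overridden -ambiguous-paths".
Set Warnings "-redundant-canonical-projection -projection-no-head-constant".
From HB Require Import structures.
From mathcomp Require Import all_boot all_fingroup all_order all_algebra all_field.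
From mathcomp Require Import boolp.
Set Implicit Arguments.
Unset Strict Implicit.
Unset Printing Implicit Defensive.
Import GRing.Theory Num.Theory.
Local Open Scope group_scope.

(* (G, S) is a Coxeter system in the sense of Bourbaki: the elements of S are
   involutions, S generates G, and the relations (s t)^m(s,t) = 1, with m(s,t)
   the order of s t, present G. The presentation is expressed by its universal
   property over all groups; the case s = t contains the relations s^2 = 1. *)
Definition is_Coxeter_system (gT : finGroupType) (S : {set gT}) : Prop :=
  [/\ {in S, forall s, #[s] = 2},
      <<S>> = [set: gT]
    & forall (H : groupType) (f : gT -> H),
        {in S &, forall s t, (f s * f t) ^+ #[s * t] = 1} ->
        exists2 h : gT -> H, {morph h : x y / x * y} & {in S, h =1 f}].

Record finCoxeterSystem := FinCoxeterSystem {
  cox_group :> finGroupType;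
  cox_gens : {set cox_group};
  cox_axiom : is_Coxeter_system cox_gens }.

Section Length.
Variable W : finCoxeterSystem.
Local Notation S := (cox_gens W).
Implicit Types (a b : seq W) (w x y s t : W) (J K L : {set W}).

Definition wprod a := \prod_(s <- a) s.

Lemma wprod_cons s a : wprod (s :: a) = s * wprod a.
Proof. exact: big_cons. Qed.

Lemma wprod_cat a b : wprod (a ++ b) = wprod a * wprod b.
Proof. exact: big_cat. Qed.

Lemma expgs_wordP L n w :
  reflect (exists a, [/\ size a = n, all (mem L) a & w = wprod a])
          (w \in L ^+ n).
Proof.
apply: (iffP idP) => [|[a [<- + ->]]].
  elim: n w => [|n IHn] w.
    by rewrite expg0 => /set1P->; exists [::]; rewrite /wprod big_nil.
  rewrite expgS => /mulsgP[s v sL /IHn[a [sz aL ->]] ->].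
  by exists (s :: a); rewrite /= sz sL aL wprod_cons.
elim: a => [|s a IHa] /=; first by rewrite /wprod big_nil expg0 set11.
by case/andP=> sL /IHa wa; rewrite wprod_cons expgS mem_mulg.
Qed.

Lemma gen_wordP L w :
  (w \in <<L>>) -> exists2 a, all (mem L) a & w = wprod a.
Proof.
case/gen_prodgP=> n [c cL ->]; exists [seq c i | i <- index_enum 'I_n].
  by apply/allP=> _ /mapP[i _ ->]; apply: cL.
by rewrite /wprod big_map.
Qed.

Lemma wprod_gen L a : all (mem L) a -> wprod a \in <<L>>.
Proof.
elim: a => [|s a IHa] /=; first by rewrite /wprod big_nil group1.
by case/andP=> sL /IHa aL; rewrite wprod_cons groupM // mem_gen.
Qed.

Lemma cox_expgs w : exists n, w \in S ^+ n.
Proof.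
have [_ gS _] := cox_axiom W.
have /gen_wordP[a aS ->] : w \in <<S>> by rewrite gS inE.
by exists (size a); apply/expgs_wordP; exists a.
Qed.

(* S ^+ n is the set of products of n elements of S. *)
Definition coxlen w : nat := ex_minn (cox_expgs w).

(* X_L; there is exactly one such representative in each left coset. *)
Definition coxmin L :=
  [set w | [forall v in w *: <<L>>, coxlen w <= coxlen v]].

Lemma coxlenP w : exists a, [/\ size a = coxlen w, all (mem S) a & w = wprod a].
Proof. by rewrite /coxlen; case: ex_minnP => n /expgs_wordP. Qed.

Lemma coxlen_le a : all (mem S) a -> coxlen (wprod a) <= size a.
Proof.
move=> aS; rewrite /coxlen; case: ex_minnP => n _ -> //.
by apply/expgs_wordP; exists a.
Qed.

Lemma coxlen_le1 s : s \in S -> coxlen s <= 1.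
Proof.
move=> sS; have := @coxlen_le [:: s]; rewrite /= sS => /(_ isT).
by rewrite /wprod big_seq1.
Qed.

Lemma coxlenM u v : coxlen (u * v) <= coxlen u + coxlen v.
Proof.
have [a [<- aS ->]] := coxlenP u; have [b [<- bS ->]] := coxlenP v.
by rewrite -wprod_cat -size_cat coxlen_le // all_cat aS.
Qed.

Lemma cox_sqr s : s \in S -> s * s = 1.
Proof.
by case: (cox_axiom W) => S2 _ _ /S2 s2; have := expg_order s; rewrite s2.
Qed.

Lemma coxV s : s \in S -> s^-1 = s.
Proof. by move/cox_sqr=> ss; apply: (mulgI s); rewrite mulgV ss. Qed.

Lemma conjsK s x : s \in S -> (x ^ s) ^ s = x.
Proof. by move=> sS; rewrite -conjgM cox_sqr // conjg1. Qed.

Lemma wprod_rev a : all (mem S) a -> wprod (rev a) = (wprod a)^-1.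
Proof.
elim: a => [|s a IHa] /=; first by rewrite /wprod big_nil invg1.
case/andP=> sS aS; rewrite rev_cons -cats1 wprod_cat IHa // [in RHS]wprod_cons invgM.
by rewrite (coxV sS) /wprod big_seq1.
Qed.

Lemma coxlenV w : coxlen w^-1 = coxlen w.
Proof.
suff le v : coxlen v^-1 <= coxlen v.
  by apply/eqP; rewrite eqn_leq le -{1}[w]invgK le.
have [a [<- aS ->]] := coxlenP v.
by rewrite -wprod_rev // -size_rev coxlen_le // all_rev.
Qed.

Lemma coxlen1 : coxlen 1 = 0.
Proof.
apply/eqP; rewrite -leqn0; have := @coxlen_le [::] isT.
by rewrite /wprod big_nil.
Qed.

Lemma coxlen_eq0 w : coxlen w = 0 -> w = 1.
Proof.
by have [a [<- _ ->]] := coxlenP w => /size0nil->; rewrite /wprod big_nil.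
Qed.

(* The action of the generators on W * bool that records, for every x, the
   parity of its occurrences in the sequence of reflections of a word. It
   satisfies the relations of the presentation, hence extends to W. *)

Definition rperm_fun s (u : W * bool) : W * bool :=
  (u.1 ^ s, u.2 (+) (u.1 == s)).

Lemma rperm_inj s : injective (rperm_fun s).
Proof.
case=> x e [y f] [] /conjg_inj -> /(congr1 (addb^~ (y == s))).
by rewrite -!addbA addbb !addbF => ->.
Qed.

Definition rperm s : {perm W * bool} := perm (@rperm_inj s).

Lemma rpermE s u : rperm s u = rperm_fun s u.
Proof. exact: permE. Qed.

Lemma rperm_iter s t n x e : s \in S -> t \in S ->
  ((rperm s * rperm t) ^+ n) (x, e) =
  (x ^ ((s * t) ^+ n),
   e (+) odd (\sum_(i < n.*2) (x == ((s * t) ^+ i * s)%g))).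
Proof.
move=> sS tS; elim: n => [|n IHn].
  by rewrite !expg0 perm1 conjg1 big_ord0 addbF.
rewrite expgSr permM IHn permM !rpermE /rperm_fun /=.
rewrite -!conjgM expgSr mulgA doubleS !big_ord_recr /= !oddD !addbA !oddb.
rewrite expgS -addnn expgD; set c := (s * t) ^+ n.
have sc : s * c^-1 = c * s.
  rewrite /c; elim: (n) => [|m IHm]; first by rewrite !expg0 invg1 mulg1 mul1g.
  rewrite {1}expgS invgM mulgA IHm -mulgA invgM !coxV // expgSr.
  by rewrite -!mulgA.
congr (_, _ (+) _ (+) _); first rewrite -(can_eq (conjgKV c)) conjgK.
  by rewrite conjgE invgK mulgA -!mulgA sc.
rewrite -(can_eq (conjgK (c * s)^-1)) -conjgM mulgV conjg1.
rewrite conjgE invgK invgM coxV // -!mulgA sc !mulgA.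
congr (x == _); congr (_ * _ * _).
by rewrite -[c * s * t]mulgA /c -expgSr -expgS.
Qed.

Lemma rperm_rel s t : s \in S -> t \in S ->
  (rperm s * rperm t) ^+ #[s * t] = 1.
Proof.
move=> sS tS; apply/permP=> -[x e]; rewrite rperm_iter // perm1 expg_order.
rewrite conjg1 -addnn big_split_ord /=.
under [X in _ + X]eq_bigr => i _ do rewrite expgD expg_order mul1g.
by rewrite oddD addbb addbF.
Qed.

Lemma cocycle_exists : exists N : W -> W -> bool,
  (forall u v x, N (u * v) x = N u x (+) N v (x ^ u)) /\
  (forall s x, s \in S -> N s x = (x == s)).
Proof.
have [_ _ univ] := cox_axiom W.
have [s t sS tS|h hM hS] := univ _ rperm; first exact: rperm_rel.
have h1 w x e : (h w (x, e)) = (x ^ w, e (+) (h w (x, false)).2).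
  have [_ gS _] := cox_axiom W.
  have /gen_wordP[a + ->] : w \in <<S>> by rewrite gS inE.
  elim: a x e => [|s a IHa] x e /=.
    rewrite /wprod big_nil (_ : h 1 = 1) ?perm1 ?conjg1 ?addbF //.
    by apply: (mulgI (h 1)); rewrite -hM !mulg1.
  case/andP=> sS aS; rewrite wprod_cons hM !permM (hS _ sS) !rpermE /rperm_fun /=.
  by rewrite IHa // [in RHS]IHa //= conjgM !addbA.
exists (fun w x => (h w (x, false)).2); split=> [u v x|s x sS].
  by rewrite hM permM h1 [in LHS]h1.
by rewrite hS // rpermE.
Qed.

Fixpoint refl a : seq W :=
  if a is s :: a' then s :: [seq x ^ s | x <- refl a'] else [::].

Lemma size_refl a : size (refl a) = size a.
Proof. by elim: a => //= s a IHa; rewrite size_map IHa. Qed.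

Lemma refl_gen L a : all (mem L) a -> {subset refl a <= <<L>>}.
Proof.
elim: a => //= s a IHa /andP[sL aL] x; rewrite inE => /predU1P[->|].
  exact: mem_gen.
by case/mapP=> y /(IHa aL) yL ->; rewrite groupJ // mem_gen.
Qed.

Lemma refl_exchange a x : all (mem S) a -> x \in refl a ->
  exists b, [/\ subseq b a, (size b).+1 = size a & x * wprod a = wprod b].
Proof.
elim: a x => //= s a IHa x /andP[sS aS]; rewrite inE => /predU1P[->|].
  exists a; split; [exact: (subseq_cons a s) | by [] |].
  by rewrite wprod_cons mulgA cox_sqr // mul1g.
case/mapP=> y /(IHa _ aS)[b [ba sb yb]] ->; exists (s :: b); split.
- by rewrite /= eqxx.
- by rewrite /= sb.
by rewrite !wprod_cons -yb conjgE coxV // -!mulgA (mulgA s s) cox_sqr // mul1g.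
Qed.

Lemma refl_deletion a : all (mem S) a -> ~~ uniq (refl a) ->
  exists b, [/\ subseq b a, size b < size a & wprod a = wprod b].
Proof.
elim: a => //= s a IHa /andP[sS aS]; rewrite negb_and negbK => /orP[|].
  case/mapP=> y ya sy; have {}sy : s = y.
    by rewrite -(conjsK y sS) -sy conjgE mulKg.
  have [b [ba sb yb]] := refl_exchange aS ya.
  exists b; split; first exact: subseq_trans ba (subseq_cons _ _).
    by rewrite -sb ltnS ltnW.
  by rewrite wprod_cons sy.
rewrite map_inj_uniq; last exact: conjg_inj.
case/(IHa aS)=> b [ba sb ab]; exists (s :: b).
by rewrite /= eqxx ltnS !wprod_cons ab.
Qed.

(* N w x holds iff x is a left inversion of w, i.e., x is a reflection and x w
   is shorter than w. *)
Section Cocycle.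
Variable N : W -> W -> bool.
Hypothesis NM : forall u v x, N (u * v) x = N u x (+) N v (x ^ u).
Hypothesis NS : forall s x, s \in S -> N s x = (x == s).

Lemma N1 x : N 1 x = false.
Proof. by have := NM 1 1 x; rewrite mulg1 conjg1 addbb. Qed.

Lemma Nword a x : all (mem S) a -> N (wprod a) x = odd (count_mem x (refl a)).
Proof.
elim: a x => [|s a IHa] x /=; first by rewrite /wprod big_nil N1.
case/andP=> sS aS; rewrite wprod_cons NM NS // IHa // oddD oddb eq_sym.
congr (_ (+) odd _); rewrite count_map; apply: eq_count => y /=.
by rewrite -(inj_eq (@conjg_inj _ s)) conjsK.
Qed.

Lemma reduced_uniq a : all (mem S) a -> size a = coxlen (wprod a) ->
  uniq (refl a).
Proof.
move=> aS sz; apply: contraT => /(refl_deletion aS)[b [ba sb ab]].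
have := coxlen_le (a := b); rewrite -ab -sz leqNgt sb => bS.
by apply: bS; apply/allP=> x /(mem_subseq ba) /(allP aS).
Qed.


Lemma card_N w : #|[set x | N w x]| = coxlen w.
Proof.
have [a [sz aS Ew]] := coxlenP w; rewrite Ew in sz *.
have ua := reduced_uniq aS sz; rewrite -sz -size_refl -(card_uniqP ua).
by apply: eq_card => x; rewrite inE Nword // count_uniq_mem // oddb.
Qed.

Lemma N_gen L w x : L \subset S -> w \in <<L>> -> N w x -> x \in <<L>>.
Proof.
move=> /subsetP LS /gen_wordP[a aL ->].
have aS : all (mem S) a by apply/allP=> y /(allP aL) /LS.
rewrite Nword // => xa; apply: (refl_gen aL).
by rewrite -has_pred1 has_count; case: count xa.
Qed.

Lemma N_lt w x : N w x -> coxlen (x * w) < coxlen w.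
Proof.
have [a [<- aS ->]] := coxlenP w; rewrite Nword // => xa.
have : x \in refl a by rewrite -has_pred1 has_count; case: count xa.
case/(refl_exchange aS)=> b [ba sb ->]; rewrite -sb ltnS coxlen_le //.
by apply/allP=> y /(mem_subseq ba) /(allP aS).
Qed.

Lemma NsE w s : s \in S -> N w s = (coxlen (s * w) < coxlen w).
Proof.
move=> sS; apply/idP/idP=> [/N_lt//|]; apply: contraLR => Nws.
rewrite -leqNgt ltnW //; have /N_lt : N (s * w) s.
  by rewrite NM NS // eqxx conjgE mulKg (negPf Nws).
by rewrite mulgA cox_sqr // mul1g.
Qed.

Lemma gen_reduced L w : L \subset S -> w \in <<L>> ->
  exists a, [/\ size a = coxlen w, all (mem L) a & w = wprod a].
Proof.
move=> /subsetP LS /gen_wordP[a aL ->].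
have [n le_an] := ubnP (size a); elim: n => // n IHn in a aL le_an *.
have aS : all (mem S) a by apply/allP=> y /(allP aL) /LS.
have [ua|/(refl_deletion aS)[b [ba sb ->]]] := boolP (uniq (refl a)).
  exists a; split=> //; rewrite -card_N -size_refl -(card_uniqP ua).
  by apply: eq_card => x; rewrite inE Nword // count_uniq_mem // oddb.
apply: IHn; last exact: leq_trans sb le_an.
by apply/allP=> y /(mem_subseq ba) /(allP aL).
Qed.

Lemma gen_len1 L w : L \subset S -> w \in <<L>> -> coxlen w <= 1 -> w != 1 ->
  w \in L.
Proof.
move=> LS wL; have [a [<- + ->]] := gen_reduced LS wL.
case: a => [|s [|//]] /=; first by rewrite /wprod big_nil eqxx.
by rewrite /wprod big_seq1 andbT.
Qed.

Definition lmin L w := [forall x in <<L>>, coxlen w <= coxlen (x * w)].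

Lemma lmin_N L w x : lmin L w -> x \in <<L>> -> N w x = false.
Proof.
move=> /forall_inP min /min; apply: contraTF => /N_lt.
by rewrite ltnNge.
Qed.

Lemma lmin_coxlenM L w x : L \subset S -> lmin L w -> x \in <<L>> ->
  coxlen (x * w) = (coxlen x + coxlen w)%N.
Proof.
move=> LS minw xL; rewrite -!card_N.
rewrite -(cardsID <<L>>); congr (_ + _)%N.
  apply: eq_card => y; rewrite !inE NM; apply/andP/idP=> [[+ yL]|Nxy].
    by rewrite (lmin_N minw) ?groupJ // addbF.
  have yL := N_gen LS xL Nxy.
  by rewrite (lmin_N minw) ?groupJ // addbF.
rewrite -[RHS](card_preimset _ (@conjg_inj _ x)); apply: eq_card => y.
rewrite !inE NM; case: (boolP (y \in _)) => yL /=.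
  by rewrite (lmin_N minw) // groupJ.
by case Nxy: (N x y) => //; rewrite (N_gen LS xL Nxy) in yL.
Qed.

Lemma lmin_exists L w : exists2 x, x \in <<L>> & lmin L (x * w).
Proof.
have [x xL minx] := arg_minnP (fun x => coxlen (x * w)) (group1 <<L>>%G).
by exists x => //; apply/forall_inP=> y yL; rewrite mulgA; apply: minx; apply: groupM.
Qed.

Lemma lmin_uniq L w x : L \subset S -> lmin L w -> x \in <<L>> ->
  lmin L (x * w) -> x = 1.
Proof.
move=> LS minw xL /forall_inP/(_ x^-1); rewrite groupV mulKg => /(_ xL).
rewrite (lmin_coxlenM LS minw xL) -{2}[coxlen w]add0n leq_add2r leqn0.
by move/eqP/coxlen_eq0.
Qed.

Lemma lminP L w : L \subset S ->
  reflect {in L, forall s, N w s = false} (lmin L w).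
Proof.
move=> LS; apply: (iffP idP) => [minw s sL|NL].
  by rewrite (lmin_N minw) // mem_gen.
have [x xL minw] := lmin_exists L w.
have [Ex|] := eqVneq x 1; first by rewrite Ex mul1g in minw.
rewrite -invg_eq1 => ntx; have xVL : x^-1 \in <<L>> by rewrite groupV.
have [[|s a] [sz aL Ea]] := gen_reduced LS xVL.
  by rewrite Ea /wprod big_nil eqxx in ntx.
case/andP: aL => /= sL aL.
have sS := subsetP LS s sL.
have aG := wprod_gen aL.
have := NL s sL; rewrite NsE //; move/negbT; rewrite -leqNgt.
have -> : w = x^-1 * (x * w) by rewrite mulKg.
rewrite (lmin_coxlenM LS minw xVL) Ea wprod_cons !mulgA cox_sqr // mul1g.
rewrite -mulgA (lmin_coxlenM LS minw aG) leq_add2r -wprod_cons -Ea -sz.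
rewrite leqNgt ltnS coxlen_le //.
by apply/allP=> y /(allP aL) /(subsetP LS).
Qed.

Definition lrep L w := odflt w [pick y in <<L>> :* w | lmin L y].

Lemma lrep_spec L w :
  exists2 x, x \in <<L>> & lrep L w = x * w /\ lmin L (lrep L w).
Proof.
rewrite /lrep; case: pickP => [y /andP[/rcosetP[x xL ->] miny]|no] /=.
  by exists x.
have [x xL minx] := lmin_exists L w.
by have := no (x * w); rewrite /= mem_rcoset mulgK xL minx.
Qed.

Lemma lrepE L w x : L \subset S -> x \in <<L>> -> lmin L (x * w) ->
  lrep L w = x * w.
Proof.
move=> LS xL minx; have [y yL [Ey miny]] := lrep_spec L w; rewrite Ey in miny *.
have E : y * w = (y * x^-1) * (x * w) by rewrite !mulgA mulgVK.
rewrite E in miny *.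
by rewrite (lmin_uniq LS minx _ miny) ?mul1g // groupM ?groupV.
Qed.

Definition cpair J (u : W * W) := (lrep J u.2, u.1 * u.2).
Definition cpairV J (u : W * W) :=
  let y := lrep J (u.1 * u.2^-1) in (y^-1, y * u.2).

Lemma cpair_fwd J K u v : J \subset S -> K \subset S ->
    lmin J u^-1 -> lmin K v^-1 -> let d := lrep J v in
  [/\ lmin J d, lmin K d^-1, lmin (K :&: J :^ d) (u * v)^-1
    & cpairV J (cpair J (u, v)) = (u, v)].
Proof.
move=> JS KS minu minv d.
have [b bJ []] := lrep_spec J v; rewrite -/d => Ed mind.
have Ev : v = b^-1 * d by rewrite Ed mulKg.
split=> //.
- apply/(lminP _ KS) => k kK; have kS := subsetP KS k kK.
  rewrite NsE //; apply: contraTF minv => lt_dk.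
  apply/(lminP _ KS) => /(_ k kK); rewrite NsE //= => /negbT/negP; apply.
  rewrite -[in X in X < _](coxV kS) -invgM !coxlenV Ev -mulgA.
  rewrite (lmin_coxlenM JS mind) ?groupV //.
  apply: leq_ltn_trans (coxlenM _ _) _; rewrite ltn_add2l.
  by rewrite -coxlenV invgM coxV // -[coxlen d]coxlenV.
- apply/(lminP _ (subset_trans (subsetIl _ _) KS)) => k /setIP[kK].
  case/imsetP=> j jJ Ek; rewrite invgM NM (lmin_N minv) ?mem_gen //=.
  apply: (lmin_N minu); rewrite Ek -conjgM Ev invgM invgK mulgA mulgV mul1g.
  by rewrite groupJ // mem_gen.
have E : lrep J (d * (u * v)^-1) = u^-1.
  rewrite invgM Ev invgM invgK !mulgA mulgV mul1g.
  rewrite (@lrepE _ _ b^-1) ?groupV ?mulKg //.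
by rewrite /cpairV /= E invgK mulKg.
Qed.

Lemma cpair_bwd J K d z : J \subset S -> K \subset S ->
    lmin J d -> lmin K d^-1 -> lmin (K :&: J :^ d) z^-1 ->
    let u := cpairV J (d, z) in
  [/\ lmin J u.1^-1, lmin K u.2^-1 & cpair J u = (d, z)].
Proof.
move=> JS KS mind mindV minz; rewrite /cpairV /=; set y := lrep _ _.
have [b bJ []] := lrep_spec J (d * z^-1); rewrite -/y => Ey miny.
have Ev : y * z = b * d by rewrite Ey !mulgA mulgVK.
rewrite invgK; split=> //; last first.
  rewrite /cpair /= mulKg Ev (@lrepE _ _ b^-1) ?groupV ?mulKg //.
apply/(lminP _ KS) => k kK; have kS := subsetP KS k kK; apply/negP=> Nvk.
have := Nvk; rewrite Ev invgM NM (lmin_N mindV) ?mem_gen //=.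
set t := k ^ d^-1 => Nt.
have tJ : t \in <<J>> by apply: N_gen Nt; rewrite ?groupV.
have tdE : t * d = d * k by rewrite /t conjgE invgK mulgA mulgVK.
have tJ1 : t \in J.
  apply: gen_len1 => //.
    rewrite -(leq_add2r (coxlen d)) -(lmin_coxlenM JS mind) // tdE addnC.
    by apply: leq_trans (coxlenM _ _) _; rewrite leq_add2l coxlen_le1.
  rewrite conjg_eq1; apply: contraTneq kS => ->.
  by apply/negP=> S1; have [/(_ _ S1)] := cox_axiom W; rewrite order1.
have kI : k \in K :&: J :^ d by rewrite inE kK mem_conjg.
have IS : K :&: J :^ d \subset S := subset_trans (subsetIl _ _) KS.
have := lmin_N minz (mem_gen kI).
have -> : z^-1 = (y * z)^-1 * y by rewrite invgM mulgVK.
rewrite NM Nvk (lmin_N miny) // Ev invgM conjgM groupJ ?groupV //.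
Qed.

End Cocycle.

Lemma coxminE L w : (w \in coxmin L) = lmin L w^-1.
Proof.
rewrite inE; apply/forall_inP/forall_inP=> min x.
  move=> xL; rewrite coxlenV -(coxlenV (x * _)) invgM invgK min //.
  by rewrite mem_lcoset mulKg groupV.
rewrite mem_lcoset => wxL; rewrite -coxlenV -(coxlenV x).
have -> : x^-1 = (w^-1 * x)^-1 * w^-1 by rewrite invgM invgK mulgK.
by rewrite min // groupV.
Qed.

(* The pairs in X_J * X_K correspond to the pairs (d, z) with d a minimal
   double coset representative and z in X_(K :&: J^d), with products preserved. *)
Lemma solomon_pairs J K : J \subset S -> K \subset S ->
  exists f g : W * W -> W * W,
  [/\ forall u v, u \in coxmin J -> v \in coxmin K ->
        f (g (u, v)) = (u, v),
      forall d z, (f (d, z)).1 * (f (d, z)).2 = z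
    & forall d z, [&& (f (d, z)).1 \in coxmin J, (f (d, z)).2 \in coxmin K
                    & g (f (d, z)) == (d, z)] =
        [&& d^-1 \in coxmin J, d \in coxmin K & z \in coxmin (K :&: J :^ d)]].
Proof.
move=> JS KS; have [N [NM NS]] := cocycle_exists.
exists (cpairV J), (cpair J); split=> [u v|d z|d z].
- rewrite !coxminE => minu minv.
  by have [] := cpair_fwd NM NS JS KS minu minv.
- by rewrite /cpairV /= mulKg.
rewrite !coxminE (invgK d).
apply/and3P/and3P=> [|[md mdV mz]].
  case E: (cpairV J (d, z)) => [u v] /= [minu minv /eqP[E1 E2]].
  by have [] := cpair_fwd NM NS JS KS minu minv; rewrite E1 E2.
by have [-> -> ->] := cpair_bwd NM NS JS KS md mdV mz.
Qed.

Lemma coxmin_gens w : (w \in coxmin S) = (w == 1).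
Proof.
have [_ gS _] := cox_axiom W; rewrite inE gS.
apply/forall_inP/eqP=> [/(_ 1)|-> v _]; last by rewrite coxlen1.
by rewrite mem_lcoset inE coxlen1 leqn0 => /(_ isT)/eqP/coxlen_eq0.
Qed.

End Length.

Local Close Scope group_scope.
Local Open Scope ring_scope.

Section GroupAlgebra.
Variables (R : nzRingType) (G : finGroupType).

(* An alias, as {ffun G -> R} carries the pointwise product. *)
Definition groupAlg := {ffun G -> R}.
HB.instance Definition _ := GRing.Zmodule.on groupAlg.
Implicit Types f g h : groupAlg.

Definition galg (x : G) : groupAlg := [ffun y => (y == x)%:R].
Definition galg_mul f g : groupAlg :=
  [ffun z => \sum_x f x * g (x^-1 * z)%g].

Fact galg_mulA : associative galg_mul.
Proof.
move=> f g h; apply/ffunP=> z; rewrite !ffunE.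
transitivity (\sum_x \sum_y f x * (g (x^-1 * y)%g * h (y^-1 * z)%g)).
  apply: eq_bigr => x _; rewrite ffunE mulr_sumr (reindex_inj (mulgI x^-1)%g).
  by apply: eq_bigr => y _; rewrite invgM invgK !mulgA mulgK.
rewrite exchange_big; apply: eq_bigr => y _; rewrite ffunE mulr_suml.
by apply: eq_bigr => x _; rewrite mulrA.
Qed.

Fact galg_mul1 : left_id (galg 1) galg_mul.
Proof.
move=> f; apply/ffunP=> z; rewrite ffunE (bigD1 1%g) //= big1 => [|x /negPf nx].
  by rewrite ffunE eqxx mul1r invg1 mul1g addr0.
by rewrite ffunE nx mul0r.
Qed.

Fact galg_mulr1 : right_id (galg 1) galg_mul.
Proof.
move=> f; apply/ffunP=> z; rewrite ffunE (bigD1 z) //= big1 => [|x nx].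
  by rewrite ffunE mulVg eqxx mulr1 addr0.
rewrite ffunE -(inj_eq (mulgI x)) mulKVg mulg1 eq_sym (negPf nx) mulr0.
by [].
Qed.

Fact galg_mulDl : left_distributive galg_mul +%R.
Proof.
move=> f g h; apply/ffunP=> z; rewrite !ffunE -big_split.
by apply: eq_bigr => x _; rewrite ffunE mulrDl.
Qed.

Fact galg_mulDr : right_distributive galg_mul +%R.
Proof.
move=> f g h; apply/ffunP=> z; rewrite !ffunE -big_split.
by apply: eq_bigr => x _; rewrite ffunE mulrDr.
Qed.

Fact galg1_neq0 : galg 1 != 0.
Proof.
by apply/eqP=> /ffunP/(_ 1%g); rewrite !ffunE eqxx => /eqP; rewrite oner_eq0.
Qed.

HB.instance Definition _ := GRing.Zmodule_isNzRing.Build groupAlg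
  galg_mulA galg_mul1 galg_mulr1 galg_mulDl galg_mulDr galg1_neq0.

Lemma galgM x y : galg x * galg y = galg (x * y).
Proof.
apply/ffunP=> z; rewrite ffunE (bigD1 x) //= big1 => [|u /negPf nu].
  by rewrite !ffunE eqxx mul1r addr0 -(inj_eq (mulgI x)) mulKVg.
by rewrite ffunE nu mul0r.
Qed.

End GroupAlgebra.

Section DescentRing.
Variable W : finCoxeterSystem.
Local Notation S := (cox_gens W).
Implicit Types (J K L : {set W}).

(* x_L *)
Definition xsum L : groupAlg rat W := \sum_(w in coxmin L) galg rat w.

(* Z_W: the Z-span in QW of the x_L, L a subset of S. *)
Definition descZ : {pred groupAlg rat W} := fun x =>
  `[< exists c : {set W} -> int,
        x = \sum_(L : {set W} | L \subset S) xsum L *~ c L >].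

Lemma descZP x :
  reflect (exists c : {set W} -> int,
             x = \sum_(L : {set W} | L \subset S) xsum L *~ c L)
          (x \in descZ).
Proof. exact: asboolP. Qed.

Fact descZ_zmod : zmod_closed descZ.
Proof.
split=> [|x y /descZP[a ->] /descZP[b ->]]; apply/descZP.
  by exists (fun=> 0); rewrite big1 // => L _; rewrite mulr0z.
exists (fun L => a L - b L); rewrite -sumrB.
by apply: eq_bigr => L _; rewrite mulrzBr.
Qed.
HB.instance Definition _ := GRing.isZmodClosed.Build _ descZ descZ_zmod.

Lemma xsum_descZ L : L \subset S -> xsum L \in descZ.
Proof.
move=> LS; apply/descZP; exists (fun K => (K == L)%:Z).
rewrite (bigD1 L) //= eqxx big1 ?addr0 // => K /andP[_ /negPf->].
by rewrite mulr0z.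
Qed.

(* Solomon's theorem *)
Lemma xsumM J K : J \subset S -> K \subset S ->
  xsum J * xsum K =
  \sum_(d | (d^-1 \in coxmin J)%g && (d \in coxmin K)) xsum (K :&: J :^ d)%g.
Proof.
move=> JS KS; have [f [g [fg f2 Ef]]] := solomon_pairs JS KS.
rewrite /xsum mulr_suml.
under eq_bigr do rewrite mulr_sumr.
rewrite pair_big /= [RHS]pair_big_dep /= (reindex_onto f g) /=; last first.
  by case=> u v /andP[/= uJ vK]; apply: fg.
apply: eq_big => [[d z]|[d z] _]; first by rewrite -andbA Ef andbA.
by rewrite galgM f2.
Qed.

Lemma xsum_gens : xsum S = 1.
Proof. by rewrite /xsum (big_pred1 1%g) // => w; rewrite coxmin_gens. Qed.

Fact descZ_subring : subring_closed descZ.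
Proof.
split=> [|x y|x y /descZP[a ->] /descZP[b ->]].
- by rewrite -xsum_gens xsum_descZ.
- by case: descZ_zmod => _; apply.
rewrite mulr_suml rpred_sum // => J JS; rewrite mulr_sumr rpred_sum // => K KS.
rewrite mulrzAr mulrzAl !rpredMz // xsumM // rpred_sum // => d _.
by rewrite xsum_descZ // (subset_trans (subsetIl _ _)).
Qed.
HB.instance Definition _ := GRing.isSubringClosed.Build _ descZ descZ_subring.

Record descRing := DescRing {
  descval :> groupAlg rat W; _ : descval \in descZ }.
HB.instance Definition _ := [isSub for descval].
HB.instance Definition _ := [Choice of descRing by <:].
HB.instance Definition _ := [SubChoice_isSubNzRing of descRing by <:].

Lemma descZ_int (x : groupAlg rat W) (w : W) : x \in descZ -> x w \is a Num.int.
Proof.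
pose P (f : groupAlg rat W) := f w \is a Num.int.
have P0 : P 0 by rewrite /P ffunE.
have PD f g : P f -> P g -> P (f + g) by rewrite /P ffunE; apply: rpredD.
have PN f : P f -> P (- f) by rewrite /P ffunE rpredN.
have PMn f n : P f -> P (f *+ n).
  by move=> Pf; elim: n => [|n IHn]; rewrite ?mulr0n // mulrS PD.
case/descZP=> c ->; apply: (big_ind P) => // L _.
have Px : P (xsum L).
  by apply: (big_ind P) => // u _; rewrite /P ffunE rpred_nat.
by case: (c L) => n; [|apply: PN]; apply: PMn.
Qed.

(* x_L as an element of Z_W, for L a subset of S. For other L, which are never
   used, x_L need not be in Z_W and the value is then 0. *)
Definition descx L : descRing := insubd 0 (xsum L).

Lemma descxE L : L \subset S -> val (descx L) = xsum L.
Proof. by move=> LS; rewrite insubdK // xsum_descZ. Qed.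

End DescentRing.

(* The quotient ring A / pA; ring_quotient only provides the ring structure for
   commutative A. *)
Section Reduction.
Variables (A : nzRingType) (p : nat).

Definition pmul : {pred A} := fun x => `[< exists y, x = y *+ p >].

Lemma pmulP x : reflect (exists y, x = y *+ p) (x \in pmul).
Proof. exact: asboolP. Qed.

Fact pmul_zmod : zmod_closed pmul.
Proof.
split=> [|x y /pmulP[a ->] /pmulP[b ->]]; apply/pmulP.
  by exists 0; rewrite mul0rn.
by exists (a - b); rewrite mulrnBl.
Qed.
HB.instance Definition _ := GRing.isZmodClosed.Build A pmul pmul_zmod.

Local Open Scope quotient_scope.
Definition redRing := Quotient.quot pmul.
HB.instance Definition _ := GRing.Zmodule.on redRing.

Definition red (x : A) : redRing := \pi_(Quotient.quot pmul) x.

Lemma red_eqP x y : reflect (red x = red y) (x - y \in pmul).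
Proof. by rewrite Quotient.idealrBE; apply: eqP. Qed.

Lemma redP a : exists x, a = red x.
Proof. by exists (generic_quotient.repr a); rewrite /red reprK. Qed.

Fact redD : {morph red : x y / x + y}.
Proof. exact: (Quotient.pi_add pmul). Qed.

Definition red_mul (a b : redRing) : redRing := red (generic_quotient.repr a * generic_quotient.repr b).

Lemma pmulMl x y : y \in pmul -> x * y \in pmul.
Proof. by case/pmulP=> z ->; apply/pmulP; exists (x * z); rewrite mulrnAr. Qed.

Lemma pmulMr x y : x \in pmul -> x * y \in pmul.
Proof. by case/pmulP=> z ->; apply/pmulP; exists (z * y); rewrite mulrnAl. Qed.

Fact redM x y : red (x * y) = red_mul (red x) (red y).
Proof.
have rK z : z - generic_quotient.repr (red z) \in pmul by apply/red_eqP; rewrite /red reprK.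
apply/red_eqP; set x' := generic_quotient.repr _; set y' := generic_quotient.repr _.
have -> : x * y - x' * y' = x * (y - y') + (x - x') * y'.
  by rewrite mulrBr mulrBl addrA subrK.
apply: rpredD; [exact/pmulMl/rK | exact/pmulMr/rK].
Qed.

Fact red_mulA : associative red_mul.
Proof.
move=> a b c; have [[[x ->] [y ->]] [z ->]] := (redP a, redP b, redP c).
by rewrite -!redM mulrA.
Qed.

Fact red_mul1r : left_id (red 1) red_mul.
Proof. by move=> a; have [x ->] := redP a; rewrite -redM mul1r. Qed.

Fact red_mulr1 : right_id (red 1) red_mul.
Proof. by move=> a; have [x ->] := redP a; rewrite -redM mulr1. Qed.

Fact red_mulDl : left_distributive red_mul +%R.
Proof.
move=> a b c; have [[[x ->] [y ->]] [z ->]] := (redP a, redP b, redP c).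
by rewrite -redD -!redM -redD mulrDl.
Qed.

Fact red_mulDr : right_distributive red_mul +%R.
Proof.
move=> a b c; have [[[x ->] [y ->]] [z ->]] := (redP a, redP b, redP c).
by rewrite -redD -!redM -redD mulrDr.
Qed.

HB.instance Definition _ := GRing.Zmodule_isPzRing.Build redRing
  red_mulA red_mul1r red_mulr1 red_mulDl red_mulDr.

Fact red_zmod_morphism : zmod_morphism red.
Proof. by move=> x y; apply: (addIr (red y)); rewrite -redD !subrK. Qed.

Fact red_monoid_morphism : monoid_morphism red.
Proof. by split=> // x y; apply: redM. Qed.

HB.instance Definition _ :=
  GRing.isZmodMorphism.Build A redRing red red_zmod_morphism.
HB.instance Definition _ :=
  GRing.isMonoidMorphism.Build A redRing red red_monoid_morphism.

End Reduction.

Section ModularDescentAlgebra.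
Variables (W : finCoxeterSystem) (p : nat) (p_pr : prime p).
Local Notation S := (cox_gens W).

Definition modDescRing of prime p := redRing (descRing W) p.
HB.instance Definition _ := GRing.PzRing.on (modDescRing p_pr).

Fact modDescRing_neq0 : 1 != 0 :> modDescRing p_pr.
Proof.
have -> : 1 = red p (1 : descRing W) :> modDescRing p_pr by rewrite rmorph1.
rewrite -[0](rmorph0 (red p)); apply/negP => /eqP/red_eqP.
rewrite subr0 => /pmulP[y] /(congr1 val); rewrite rmorphMn rmorph1 /=.
move=> E; have := congr1 (fun f : groupAlg rat W => f 1%g) E.
have -> n (f : groupAlg rat W) : (f *+ n) 1%g = f 1%g *+ n.
  by rewrite ffunMnE.
rewrite ffunE eqxx; have /intrP[m ->] := descZ_int 1%g (valP y).
move=> Em; have E1 : 1%:~R = (m * p%:Z)%:~R :> rat.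
  by rewrite intrM; move: Em; rewrite -[in X in _ = X]mulr_natr => <-.
move/intr_inj: E1 => E1.
have : (p %| 1)%Z by apply/dvdzP; exists m.
by rewrite dvdz1 /= => /eqP p1; have := p_pr; rewrite p1.
Qed.

HB.instance Definition _ :=
  GRing.PzSemiRing_isNonZero.Build (modDescRing p_pr) modDescRing_neq0.

Fact modDescRing_pchar : p \in [pchar (modDescRing p_pr)].
Proof.
rewrite inE p_pr; apply/eqP.
have -> : p%:R = red p (p%:R : descRing W) :> modDescRing p_pr.
  by rewrite rmorph_nat.
rewrite -[RHS](rmorph0 (red p)); apply/red_eqP/pmulP.
by exists 1; rewrite subr0.
Qed.

(* Sigma(W, p) as an algebra over 'F_p, with a *: x = a%:R * x. *)
Definition modDescAlg := pPrimeCharType modDescRing_pchar.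
HB.instance Definition _ := GRing.Algebra.on modDescAlg.

Definition rho1 (x : descRing W) : modDescAlg := red p x.
HB.instance Definition _ := GRing.isZmodMorphism.Build
  (descRing W) modDescAlg rho1 (@red_zmod_morphism _ p).
HB.instance Definition _ := GRing.isMonoidMorphism.Build
  (descRing W) modDescAlg rho1 (@red_monoid_morphism _ p).
Definition xbar (L : {set W}) : modDescAlg := rho1 (descx L).

End ModularDescentAlgebra.

Section PermutationCharacters.
Variable W : finCoxeterSystem.
Local Notation S := (cox_gens W).
Implicit Types (K : {set W}) (f : {ffun W -> int}).

(* chi_K: w fixes a left coset C of W_K iff w C = C. *)
Definition permchar K : {ffun W -> int} :=
  [ffun w => #|[set C in lcosets <<K>> [set: W] | w *: C == C]%g|%:Z].

(* G_W *)
Definition permcharZ f : Prop :=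
  exists c : {set W} -> int,
    f = \sum_(K : {set W} | K \subset S) permchar K *~ c K.

(* ('F_p)^o is 'F_p as a vector space over itself; it gives functions to 'F_p
   their 'F_p-vector space structure, on top of the pointwise ring structure. *)
Definition rho2 (p : nat) f : {ffun W -> ('F_p)^o} := [ffun w => (f w)%:~R].

(* G(W, p) *)
Definition modPermchar (p : nat) (g : {ffun W -> ('F_p)^o}) : Prop :=
  exists2 f, permcharZ f & g = rho2 p f.
End PermutationCharacters.

Section Radical.
Variable A : nzRingType.
Implicit Types (I M : A -> Prop).

Definition left_ideal I : Prop :=
  [/\ I 0, forall x y, I x -> I y -> I (x + y) & forall a x, I x -> I (a * x)].

Definition maximal_left_ideal M : Prop :=
  [/\ left_ideal M, ~ M 1
    & forall I, left_ideal I -> (forall x, M x -> I x) -> ~ I 1 ->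
        forall x, I x -> M x].

(* The intersection of all maximal left ideals. *)
Definition jacobson_radical (x : A) : Prop :=
  forall M, maximal_left_ideal M -> M x.
End Radical.

Definition lin_span (F : nzRingType) (V : lmodType F) (X : V -> Prop) (v : V) :
    Prop :=
  exists n (c : 'I_n -> F) (u : 'I_n -> V),
    (forall i, X (u i)) /\ v = \sum_(i < n) c i *: u i.

(* Main.v *)
Require Import Defs.
Set Warnings "-notation-overridden -ambiguous-paths".
Set Warnings "-redundant-canonical-projection".
From HB Require Import structures.
From mathcomp Require Import all_boot all_fingroup all_order all_algebra all_field.
From mathcomp Require Import boolp ring.
Import GRing.Theory Num.Theory.
Set Implicit Arguments.
Unset Strict Implicit.
Unset Printing Implicit Defensive.

(** For a subset H of W, counting the cosets of W_K fixed by H gives a ring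
    morphism mark_H from Z_W to the integers (Mackey's formula), with
    mark_H(x_K) = chi_K(w) for H = {w}. An element x killed by all mark_{w} is
    nilpotent: the sum of the mark_{w}(x) is |W| times the coefficient of 1 in x,
    so all powers of x have trace 0 in the regular representation of W. It
    follows that each W_J contains an element g with mark_{g} = mark_{W_J}, as
    otherwise one could build a non-nilpotent element killed by all mark_{w}.

    Left multiplication by x is triangular in the basis (x_K) ordered by
    inclusion, with diagonal entries mark_{W_K}(x). These are 0 modulo p when
    phi(x) = 0, so ker phi is a nil ideal and lies in the radical; conversely
    the radical lies in the kernels of the evaluations of phi at the elements
    of W, which are maximal. Finally mark_{W_J}(x_K) is 0 unless J is
    conjugate to a subset of K, and mark_{W_J}(x_J) = [N(W_J) : W_J], so that
    the chi_J mod p with p not dividing [N(W_J) : W_J], for J up to conjugacy,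
    are linearly independent. *)

(** * Fixed points of subgroups on the cosets of parabolic subgroups *)

Section FixedCosets.
Local Open Scope group_scope.
Variable W : finCoxeterSystem.
Local Notation S := (cox_gens W).
Implicit Types (u v w x y d h : W) (H J K L : {set W}).

(** [lrep] is minimal in a right coset of [<<L>>]; the two inverses turn it into the minimal element
    of the left coset of [w]. *)
Definition crep L w := (lrep L w^-1)^-1.

Lemma crep_coxmin L w : crep L w \in coxmin L.
Proof. by rewrite coxminE invgK; have [x _ []] := lrep_spec L w^-1. Qed.

Lemma crep_coset L w : (crep L w)^-1 * w \in <<L>>.
Proof.
by rewrite invgK; have [x xL [-> _]] := lrep_spec L w^-1; rewrite mulgVK.
Qed.

Lemma coxmin_unique L u x : L \subset S -> u \in coxmin L -> x \in <<L>> ->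
  u * x \in coxmin L -> x = 1.
Proof.
have [N [NM NS]] := cocycle_exists W.
rewrite !coxminE invgM => LS minu xL minux; apply/eqP; rewrite -invg_eq1.
by apply/eqP/(lmin_uniq NM NS LS minu); rewrite ?groupV.
Qed.

Lemma crepM L u x : L \subset S -> u \in coxmin L -> x \in <<L>> ->
  crep L (u * x) = u.
Proof.
move=> LS uL xL; have := crep_coset L (u * x).
set v := crep L _ => vL.
have Ev : u * (u^-1 * v) = v by rewrite mulKVg.
have/(coxmin_unique LS uL) : u^-1 * v \in <<L>>.
  have -> : u^-1 * v = x * (v^-1 * (u * x))^-1 by rewrite !invgM invgK !mulgA mulgV mul1g.
  by rewrite groupM ?groupV.
by rewrite Ev => /(_ (crep_coxmin _ _)) /eqP; rewrite -eq_mulVg1 => /eqP.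
Qed.

(** Each [w] is uniquely [u * x] with [u] in [coxmin L] and [x] in [<<L>>], and [P] depends only on
    [u]. *)
Lemma card_coxmin L (P : pred W) : L \subset S ->
    (forall w x, x \in <<L>> -> P (w * x) = P w) ->
  #|[set w | P w]| = (#|[set u in coxmin L | P u]| * #|<<L>>|)%N.
Proof.
move=> LS PL; rewrite -cardsX.
rewrite -(@card_in_imset _ _ (fun u : W * W => u.1 * u.2)).
  apply: eq_card => w; rewrite in_set; apply/idP/imsetP=> [Pw|[[u x]]].
    exists (crep L w, (crep L w)^-1 * w); last by rewrite mulKVg.
    rewrite in_setX in_set /= crep_coset crep_coxmin -(PL _ _ (crep_coset L w)).
    by rewrite mulKVg Pw.
  by rewrite in_setX in_set /= => /andP[/andP[_ Pu] xL] ->; rewrite PL.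
move=> [u x] [v y] /setXP[/setIdP[uL _] xL] /setXP[/setIdP[vL _] yL] /= E.
have Eu : u = v by rewrite -(crepM LS uL xL) E crepM.
by move: E; rewrite Eu => /mulgI->.
Qed.

(* The number of cosets of <<K>> fixed by all the elements of H. *)
Definition fixnum H K := #|[set u in coxmin K | H :^ u \subset <<K>>]|.

Lemma conj_sub_genM H K w x : x \in <<K>> ->
  (H :^ (w * x) \subset <<K>>) = (H :^ w \subset <<K>>).
Proof. by move=> xK; rewrite conjsgM -{1}(conjGid xK) conjSg. Qed.

Lemma fixnum_card H K : K \subset S ->
  #|[set w | H :^ w \subset <<K>>]| = (fixnum H K * #|<<K>>|)%N.
Proof. by move=> KS; apply: card_coxmin => // w x; apply: conj_sub_genM. Qed.

Lemma fixnumJ H K u : K \subset S -> fixnum (H :^ u) K = fixnum H K.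
Proof.
move=> KS; apply/eqP; rewrite -(eqn_pmul2r (cardG_gt0 <<K>>)) -!fixnum_card //.
rewrite -[X in _ == X](card_preimset _ (mulgI u)).
by apply/eqP/eq_card => w; rewrite !in_set conjsgM.
Qed.

(** The left coset of [u] is fixed by [w] exactly when [w ^ u] lies in [<<K>>]. *)
Lemma permchar_fixnum K w : K \subset S ->
  permchar K w = (fixnum [set w] K)%:Z%R.
Proof.
move=> KS; rewrite ffunE /fixnum; congr (_%:Z%R).
rewrite -(@card_in_imset _ _ (fun u => u *: <<K>>)).
  apply: eq_card => C; rewrite in_set; apply/andP/imsetP.
    case=> /lcosetsP[v _ ->] /eqP fC; have vK := crep_coset K v.
    have EC : v *: <<K>> = crep K v *: <<K>>.
      by apply/lcoset_eqP; rewrite mem_lcoset.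
    exists (crep K v) => //; rewrite in_set crep_coxmin conjg_set1 sub1set.
    by rewrite conjgE -mem_lcoset -EC -fC EC mem_lcoset mulKg mem_lcoset mulVg group1.
  case=> u; rewrite in_set conjg_set1 sub1set => /andP[uK wu] ->.
  split; first by apply/lcosetsP; exists u; rewrite ?in_set.
  rewrite -lcosetM; apply/eqP/lcoset_eqP; rewrite mem_lcoset.
  by rewrite -conjgE.
move=> u v /setIdP[uK _] /setIdP[vK _] /lcoset_eqP.
rewrite mem_lcoset => /(crepM KS vK).
by rewrite mulKVg -{1}[u]mulg1 crepM.
Qed.

(* Kilmoyer's theorem *)
Lemma coxmin_capJ J K d : J \subset S -> K \subset S ->
    d^-1 \in coxmin J -> d \in coxmin K ->
  <<J>> :^ d :&: <<K>> = <<K :&: J :^ d>>.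
Proof.
have [N [NM NS]] := cocycle_exists W.
move=> JS KS mJ mK; set L := K :&: _.
have LS : L \subset S := subset_trans (subsetIl _ _) KS.
have sLK : <<L>> \subset <<K>> by apply/genS/subsetIl.
have sLJ : <<L>> \subset <<J>> :^ d.
  by rewrite -genJ; apply/genS/subsetIr.
apply/eqP; rewrite eqEsubset subsetI sLK sLJ !andbT.
apply/subsetP=> h /setIP[hJ hK]; rewrite -[h](mulKVg (crep L h)).
have := crep_coset L h; have := crep_coxmin L h; move: (crep L h) => z zL hzL.
rewrite groupM //.
have Ez : z = h * (z^-1 * h)^-1 by rewrite invgM invgK mulKVg.
have zK : z \in <<K>> by rewrite Ez groupM // groupV (subsetP sLK).
have zJ : z ^ d^-1 \in <<J>>.
  by rewrite -mem_conjg Ez groupM // groupV (subsetP sLJ).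
have mJ' : lmin J d by rewrite -[d]invgK -coxminE.
have mK' : lmin K d^-1 by rewrite -coxminE.
have mz' : lmin L z^-1 by rewrite -coxminE.
(* The pair attached to [(d, z)] is [(d^-1, d * z)], because [d] is the minimal element of the right
   coset of [<<J>>] containing [d * z^-1]. So [d] and [d * z] are both minimal in one left coset of
   [<<K>>], which forces [z = 1]. *)
have [_] := cpair_bwd NM NS JS KS mJ' mK' mz'.
have Edz : d * z^-1 = (z ^ d^-1)^-1 * d by rewrite conjgE !invgM !invgK mulgVK.
rewrite /cpairV /= Edz (lrepE NM NS (x := z ^ d^-1)) ?mulKVg // => + _.
rewrite -coxminE => /(coxmin_unique KS mK zK) ->.
exact: group1.
Qed.

(** Both sides count pairs: the bijection [cpair] sends [(u, v)] to [(d, z)] with [z = u * v], and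
    Kilmoyer's theorem merges the conditions that [H :^ z] lie in [<<J>> :^ d] and in [<<K>>]. *)
Lemma fixnumM H J K : J \subset S -> K \subset S ->
  (fixnum H J * fixnum H K)%N =
  \sum_(d | (d^-1 \in coxmin J) && (d \in coxmin K)) fixnum H (K :&: J :^ d).
Proof.
have [N [NM NS]] := cocycle_exists W.
move=> JS KS.
pose P u v := [&& u \in coxmin J, v \in coxmin K, H :^ u \subset <<J>>
                & H :^ (u * v) \subset <<K>>].
transitivity (\sum_u \sum_(v | P u v) 1).
  rewrite {1}/fixnum -sum1_card big_distrl /= big_mkcond /=.
  apply: eq_bigr => u _; rewrite in_set /P; case: (u \in _) => /=; last first.
    by rewrite big1.
  case: ifP => Hu; last by rewrite big1 // => v; rewrite andbF.
  rewrite mul1n -(fixnumJ H u KS) /fixnum -sum1_card.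
  by apply: eq_bigl => v; rewrite in_set conjsgM /=.
pose Q d z := [&& d^-1 \in coxmin J, d \in coxmin K, z \in coxmin (K :&: J :^ d)
                & H :^ z \subset <<K :&: J :^ d>>].
transitivity (\sum_d \sum_(z | Q d z) 1); last first.
  rewrite [RHS]big_mkcond; apply: eq_bigr => d _ /=; rewrite /Q.
  case: (d^-1 \in _); last by rewrite big1.
  case: (d \in _); last by rewrite big1.
  by rewrite /fixnum -sum1_card; apply: eq_bigl => z; rewrite in_set.
rewrite !pair_big_dep /=.
have [f fE] : exists f, f = cpairV J by exists (cpairV J).
rewrite (reindex_onto f (cpair J)) /=; last first.
  case=> u v /and4P[]; rewrite fE !coxminE => minu minv _ _.
  by have [] := cpair_fwd NM NS JS KS minu minv.
apply: eq_bigl => -[d z].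
(* [v] and [d] lie in the same right coset of [<<J>>], hence conjugate [<<J>>] to the same subgroup;
   the inclusion is then conjugated by [v]. *)
have transfer u v : cpair J (u, v) = (d, z) ->
    (H :^ u \subset <<J>>) = (H :^ z \subset <<J>> :^ d).
  have [b bJ [Eb _]] := lrep_spec J v.
  rewrite /cpair /= => -[<- <-]; rewrite Eb.
  by rewrite (conjsgM _ b v) (conjGid bJ) (conjsgM _ u v) conjSg.
apply/andP/and4P=> [[/and4P[]]|[]]; case Euv: (f (d, z)) => [u v].
  move=> uJ vK Hu Huv /eqP Edz. rewrite (transfer _ _ Edz) in Hu.
  rewrite !coxminE in uJ vK *; have [] := cpair_fwd NM NS JS KS uJ vK.
  case: Edz => -> Ez; rewrite Ez in Huv *; move=> mJ mK -> _; rewrite invgK mJ mK.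
  by rewrite -coxmin_capJ ?coxminE ?invgK // subsetI Hu.
move=> mJ mK mz; rewrite -(coxmin_capJ JS KS mJ mK) subsetI => /andP[HJ HK].
rewrite !coxminE ?invgK in mJ mK mz; have [] := cpair_bwd NM NS JS KS mJ mK mz.
rewrite -fE Euv /P !coxminE => /= -> -> Edz; rewrite (transfer _ _ Edz) HJ.
by case: (Edz) => _ ->; rewrite HK Edz.
Qed.

Lemma cox_neq1 s : s \in S -> s != 1.
Proof.
apply: contraTneq => ->; apply/negP=> S1.
by have [/(_ _ S1)] := cox_axiom W; rewrite order1.
Qed.

Lemma cox_mem_gen K s : K \subset S -> s \in S -> (s \in <<K>>) = (s \in K).
Proof.
have [N [NM NS]] := cocycle_exists W.
move=> KS sS; apply/idP/idP=> [sK|]; last exact: mem_gen.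
by apply: (gen_len1 NM NS KS sK) (coxlen_le1 sS) (cox_neq1 sS).
Qed.

Lemma coxmin1 L : 1 \in coxmin L.
Proof. by rewrite coxminE; apply/forall_inP=> x _; rewrite invg1 coxlen1. Qed.

(** If [<<K>> :^ u] lies in [<<J>>], the minimal element [d] of the double coset of [u^-1] satisfies
    [<<K>> \subset <<J>> :^ d]. Kilmoyer's theorem then puts each generator of [K] in
    [<<K :&: J :^ d>>], hence in [J :^ d]. *)
Lemma fixnum_gen_neq0 J K : J \subset S -> K \subset S ->
  fixnum <<K>> J != 0 -> exists d, K \subset J :^ d.
Proof.
have [N [NM NS]] := cocycle_exists W.
move=> JS KS; rewrite -lt0n => /card_gt0P[u /setIdP[uJ Ku]].
have KuJ : <<K>> \subset <<J>> :^ u^-1 by rewrite -sub_conjg.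
have vK := crep_coxmin K u^-1; have := crep_coset K u^-1.
move: (crep K u^-1) vK => v; rewrite coxminE => vK kK.
have min1 : lmin J 1^-1 by rewrite -coxminE coxmin1.
have [mJ mK _ _] := cpair_fwd NM NS JS KS min1 vK.
have [b bJ [Ed _]] := lrep_spec J v; move: (lrep J v) Ed mJ mK => d Ed mJ mK.
exists d; have KJ : <<K>> \subset <<J>> :^ d.
  rewrite Ed conjsgM (conjGid bJ) -(conjSg _ _ (v^-1 * u^-1)).
  by rewrite (conjGid kK) -conjsgM mulKVg.
apply/subsetP=> s sK; have sS := subsetP KS s sK.
have : s \in <<J>> :^ d :&: <<K>> by rewrite inE (subsetP KJ) mem_gen.
rewrite (coxmin_capJ JS KS) ?coxminE ?invgK // cox_mem_gen //.
  by case/setIP.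
exact: subset_trans (subsetIl _ _) KS.
Qed.

Lemma fixnum_proper K L : K \subset S -> L \proper K -> fixnum <<K>> L = 0.
Proof.
move=> KS LK; apply/eqP/contraT => /fixnum_gen_neq0[||d /subset_leq_card] //.
  exact: subset_trans (proper_sub LK) KS.
by rewrite cardJg leqNgt proper_card.
Qed.

Lemma fixnum_norm J : J \subset S -> fixnum <<J>> J = #|'N(<<J>>) : <<J>>|.
Proof.
move=> JS; apply/eqP; rewrite -(eqn_pmul2r (cardG_gt0 <<J>>)) -fixnum_card //.
rewrite mulnC Lagrange ?normG //; by apply/eqP/eq_card => w; rewrite !inE.
Qed.

(** ['N(<<J>>)] acts freely by right translation on the set of [w] with [H :^ w] inside [<<J>>], so
    its order divides the size of that set. *)
Lemma norm_dvd_fixnum H J : J \subset S ->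
  #|'N(<<J>>) : <<J>>| %| fixnum H J.
Proof.
move=> JS; rewrite -(dvdn_pmul2r (cardG_gt0 <<J>>)) -fixnum_card //.
rewrite mulnC Lagrange ?normG //; set A := [set w | _].
have AN : [acts 'N(<<J>>), on A | 'R].
  apply/actsP=> n nN w /=; rewrite !inE conjsgM.
  by rewrite -{1}(normP nN) conjSg.
rewrite -(acts_sum_card_orbit AN); apply: dvdn_sum => _ /imsetP[w _ ->].
by rewrite orbitR card_lcoset.
Qed.

Lemma fixnum_conj H J K w : J \subset S -> K \subset S -> J :^ w = K ->
  fixnum H J = fixnum H K.
Proof.
move=> JS KS JK; have JKg : <<J>> :^ w = <<K>> by rewrite -genJ JK.
apply/eqP; rewrite -(eqn_pmul2r (cardG_gt0 <<J>>)) -fixnum_card //.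
rewrite -{1}(cardJg <<J>> w) JKg -fixnum_card // -[X in _ == X](card_preimset _ (mulIg w)).
by apply/eqP/eq_card => x; rewrite !inE -JKg conjsgM conjSg.
Qed.

Lemma fixnum_sub H H' K : H' \subset H -> fixnum H K <= fixnum H' K.
Proof.
move=> HH; apply/subset_leq_card/subsetP=> u /setIdP[uK Hu].
by rewrite in_set uK (subset_trans _ Hu) // conjSg.
Qed.

Lemma fixnum_max H K : fixnum H K <= #|W|.
Proof. exact: max_card. Qed.

(** Double counting: the coset of [u] is fixed exactly by the elements of [<<K>> :^ u^-1]. *)
Lemma sum_fixnum K : K \subset S -> \sum_w fixnum [set w] K = #|W|.
Proof.
move=> KS; rewrite /fixnum.
under eq_bigr => w _ do rewrite -sum1_card big_mkcond /=.
rewrite exchange_big /=.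
transitivity (\sum_(u in coxmin K) #|<<K>>|).
  rewrite [RHS]big_mkcond; apply: eq_bigr => u _ /=.
  case: ifP => uK; last by rewrite big1 // => w _; rewrite in_set uK.
  rewrite -big_mkcond -(cardJg <<K>> u^-1) -sum1_card; apply: eq_bigl => w.
  by rewrite in_set uK conjg_set1 sub1set mem_conjgV.
rewrite sum_nat_const; have := card_coxmin (P := predT) KS.
move=> /(_ (fun _ _ _ => erefl)); rewrite cardsT => ->.
by congr (_ * _)%N; apply: eq_card => u; rewrite in_set andbT.
Qed.

(** The witness is the inverse of a longest element [x] of [<<K>>]: the generators [s] for which
    [s * x] is shorter than [x] are exactly those in [K]. *)
Lemma descent_class K : K \subset S ->
  exists w, forall L, L \subset S -> (w \in coxmin L) = [disjoint L & K].
Proof.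
have [N [NM NS]] := cocycle_exists W.
move=> KS; have [x xK maxx] := arg_maxnP (@coxlen W) (group1 <<K>>%G).
exists x^-1 => L LS; rewrite coxminE invgK.
have NxE s : s \in S -> N x s = (s \in K).
  move=> sS; apply/idP/idP=> [/(N_gen NM NS KS xK)|sK].
    by rewrite cox_mem_gen.
  apply: contraT => Nxs; have : N (s * x) s.
    by rewrite NM NS // eqxx conjgE mulKg (negPf Nxs).
  rewrite NsE // mulgA cox_sqr // mul1g ltnNge.
  by case/negP; apply: maxx; apply: groupM (mem_gen sK) xK.
apply/(lminP NM NS _ LS)/pred0P=> [NL s|dLK s sL].
  apply/andP=> -[/= sL]; rewrite -NxE ?(subsetP LS) // => Nx.
  by move: (NL s sL); rewrite Nx.
by rewrite NxE ?(subsetP LS) //; have := dLK s; rewrite /= sL.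
Qed.

Local Open Scope ring_scope.

Lemma xsumE L w : xsum L w = (w \in coxmin L)%:R.
Proof.
rewrite /xsum sum_ffunE; under eq_bigr => u _ do rewrite ffunE.
rewrite big_mkcond (bigD1 w) //= eqxx big1 ?addr0; first by case: ifP.
by move=> u /negPf; rewrite eq_sym => ->; rewrite if_same.
Qed.

Lemma xsum_combE (c : {set W} -> int) w :
  (\sum_(L : {set W} | L \subset S) xsum L *~ c L) w =
  (\sum_(L : {set W} | (L \subset S) && (w \in coxmin L)) c L)%:~R.
Proof.
rewrite sum_ffunE raddf_sum big_mkcondr; apply: eq_bigr => L _ /=.
have -> : (xsum L *~ c L) w = xsum L w *~ c L.
  by case: (c L) => n; rewrite ?NegzE ?mulrNz ?ffunE ffunMnE.
by rewrite xsumE; case: (w \in _); rewrite ?mul0rz.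
Qed.

(** The element given by [descent_class] for [S :\: L] lies in [coxmin M] only if [M \subset L], so
    evaluation at these elements is triangular with respect to inclusion. *)
Lemma xsum_free (c : {set W} -> int) :
    \sum_(L : {set W} | L \subset S) xsum L *~ c L = 0 ->
  forall L, L \subset S -> c L = 0.
Proof.
move=> c0 L; have [n leLn] := ubnP #|L|; elim: n => // n IHn in L leLn *.
move=> LS; have [w wE] := descent_class (subsetDl S L).
have /ffunP/(_ w) := c0; rewrite xsum_combE ffunE => /eqP.
rewrite intr_eq0 (bigD1 L) /= ?LS ?wE //; last first.
  by rewrite disjoints_subset; apply/subsetP=> s sL; rewrite !inE sL.
rewrite big1 ?addr0 => [/eqP//|M /andP[/andP[MS]]].
rewrite (wE _ MS) => dM neML; apply: IHn => //.
have ML : M \proper L.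
  rewrite properEneq neML; apply/subsetP=> s sM.
  have := disjointFr dM sM; rewrite inE (subsetP MS s sM) andbT.
  by case: (s \in L).
exact: leq_trans (proper_card ML) _.
Qed.

End FixedCosets.

Local Open Scope ring_scope.

(** * Matrices all of whose positive powers have trace zero *)

Section Nilpotency.

(** Idempotence makes the factors of a rank factorization multiply to the identity in the reverse
    order, and the trace is unchanged when they are swapped. *)
Lemma mxtrace_idem (F : fieldType) n (A : 'M[F]_n) :
  A *m A = A -> \tr A = (\rank A)%:R.
Proof.
move=> AA; have E : row_base A *m col_base A = 1%:M.
  apply: (row_full_inj (col_base_full A)); apply: (row_free_inj (row_base_free A)).
  by rewrite mulmx1 -mulmxA -[X in _ *m X = _]mulmxA mulmx_base mulmxA mulmx_base.
by rewrite -{1}(mulmx_base A) mxtrace_mulC E mxtrace1.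
Qed.

Lemma mxtrace_horner_mulX (F : fieldType) n (A : 'M[F]_n.+1) (r : {poly F}) :
    (forall k, (0 < k)%N -> \tr (A ^+ k) = 0) ->
  \tr (horner_mx A (r * 'X)) = 0.
Proof.
move=> trA; rewrite -[r]coefK poly_def mulr_suml !raddf_sum big1 // => i _ /=.
rewrite -scalerAl -exprSr linearZ /= rmorphXn /= horner_mx_X mxtraceZ trA //.
by rewrite mulr0.
Qed.

(* Otherwise Fitting's lemma gives a nonzero idempotent which is a polynomial
   in A without constant term, and its trace is its rank. *)
Lemma nilpotent_mxtrace (F : numFieldType) n (A : 'M[F]_n.+1) :
  (forall k, (0 < k)%N -> \tr (A ^+ k) = 0) -> exists k, A ^+ k = 0.
Proof.
move=> trA; have [m [q /implyP q0 Ep]] := multiplicity_XsubC (mxminpoly A) 0.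
have {}q0 : ~~ root q 0 by apply: q0; rewrite monic_neq0 ?mxminpoly_monic.
(* The exponent [m.+1] instead of [m] makes [r] below divisible by ['X] even when [m = 0]; the
   traces are only known for positive powers. *)
rewrite subr0 in Ep; have cop : coprimep ('X ^+ m.+1) q.
  by rewrite coprimep_expl // -['X]subr0 coprimep_sym coprimep_XsubC.
have [[u v] /= uv1] := Bezout_eq1_coprimepP _ _ cop.
have pA : horner_mx A (q * 'X^m) = 0 by rewrite -Ep mx_root_minpoly.
pose r := u * 'X^(m.+1); pose E := horner_mx A r.
have EE : E *m E = E.
  apply/eqP; rewrite -[E *m E]/(E * E) -rmorphM /= eq_sym -subr_eq0 -rmorphB /=.
  have -> : r - r * r = u * 'X * v * (q * 'X^m).
    have -> : r - r * r = r * (v * q).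
      by rewrite -{1}[r]mulr1 -mulrBr -uv1 addrAC subrr add0r.
    by rewrite /r exprS; ring.
  by rewrite rmorphM /= pA mulr0.
have E0 : E = 0.
  apply/eqP; rewrite -mxrank_eq0 -(eqr_nat F) -mxtrace_idem // /E /r exprSr mulrA.
  by rewrite mxtrace_horner_mulX.
exists m; rewrite -[A in LHS](horner_mx_X A) -rmorphXn /=.
rewrite -['X^m]mulr1 -uv1 -/r mulrDr rmorphD /= rmorphM /= -/E E0 mulr0 add0r.
have -> : 'X^m * (v * q) = v * (q * 'X^m) by ring.
by rewrite rmorphM /= pA mulr0.
Qed.

End Nilpotency.

(** * The regular representation of a finite group *)

Section Regular.
Variable G : finGroupType.
Let n := #|G|.-1.
Fact card_predG : n.+1 = #|G|.
Proof. by rewrite prednK //; apply/card_gt0P; exists 1%g. Qed.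
Let e (i : 'I_n.+1) : G := enum_val (cast_ord card_predG i).
Let e_bij : {on predT, bijective e}.
Proof.
apply/onW_bij/bij_comp; first exact: enum_val_bij.
by exists (cast_ord (esym card_predG)); [apply: cast_ordK | apply: cast_ordKV].
Qed.

(** The matrix of left multiplication by [f]. The size has the form [n.+1] so that the matrices form
    a ring. *)
Definition regmx (F : nzRingType) (f : groupAlg F G) : 'M[F]_n.+1 :=
  \matrix_(i, j) f (e i * (e j)^-1)%g.

Lemma regmxM (F : nzRingType) (f g : groupAlg F G) : regmx (f * g) = regmx f * regmx g.
Proof.
apply/matrixP=> i j; rewrite !mxE ffunE.
under [RHS]eq_bigr => k _ do rewrite !mxE.
rewrite -(reindex e (P := predT) (F := fun u => f (e i * u^-1)%g * g (u * (e j)^-1)%g)) //.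
rewrite [RHS](reindex (fun u => u^-1 * e i)%g) /=; last first.
  by exists (fun u => e i * u^-1)%g => u _; rewrite invgM invgK ?mulKVg ?mulgVK.
by apply: eq_bigr => u _; rewrite invgM invgK mulKVg mulgA.
Qed.

Lemma regmx_tr (F : nzRingType) (f : groupAlg F G) : \tr (regmx f) = f 1%g *+ #|G|.
Proof.
rewrite /mxtrace; under eq_bigr => i _ do rewrite mxE mulgV.
by rewrite sumr_const card_ord card_predG.
Qed.

Lemma regmx_inj (F : nzRingType) : injective (@regmx F).
Proof.
move=> f g /matrixP fg; apply/ffunP=> w.
have [e' _ eK] := e_bij.
have := fg (e' w) (e' 1%g); rewrite !mxE !eK ?inE // invg1 mulg1.
by [].
Qed.

Lemma regmx1 (F : nzRingType) : regmx (1 : groupAlg F G) = 1.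
Proof.
have [e' e'K _] := e_bij.
apply/matrixP=> i j; rewrite !mxE ffunE -eq_mulgV1 -val_eqE.
by rewrite (can_in_eq e'K) ?inE.
Qed.

Lemma regmx0 (F : nzRingType) : regmx (0 : groupAlg F G) = 0.
Proof. by apply/matrixP=> i j; rewrite !mxE ffunE. Qed.

Lemma groupAlg_nilpotent (f : groupAlg rat G) :
  (forall k, (0 < k)%N -> (f ^+ k) 1%g = 0) -> exists k, f ^+ k = 0.
Proof.
move=> f1; have regX k : regmx (f ^+ k) = regmx f ^+ k.
  by elim: k => [|k IHk]; rewrite ?regmx1 // !exprS regmxM IHk.
have [k fk|k fk] := @nilpotent_mxtrace _ _ (regmx f).
  by rewrite -regX regmx_tr f1 ?mul0rn.
by exists k; apply: regmx_inj; rewrite regX fk regmx0.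
Qed.

End Regular.

(** * The marks, and triangularity of multiplication in the descent ring *)

Section Marks.
Variable W : finCoxeterSystem.
Local Notation S := (cox_gens W).
Implicit Types (u v w d : W) (H J K L : {set W}) (x y : descRing W).

Lemma descx_span x : exists c : {set W} -> int,
  x = \sum_(L : {set W} | L \subset S) descx L *~ c L.
Proof.
have /descZP[c xE] := valP x; exists c; apply: val_inj; rewrite xE raddf_sum.
by apply: eq_bigr => L LS; rewrite raddfMz /= descxE.
Qed.

Lemma descx_free (c : {set W} -> int) :
    \sum_(L : {set W} | L \subset S) descx L *~ c L = 0 :> descRing W ->
  forall L, L \subset S -> c L = 0.
Proof.
move/(congr1 val); rewrite raddf_sum => c0; apply: xsum_free.
by rewrite -[RHS]c0; apply: eq_bigr => L LS; rewrite [RHS]raddfMz /= descxE.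
Qed.

(** A choice of coordinates, unique on the subsets of [S] by [descx_free]; [markE] thus allows any
    other coordinates. *)
Definition desc_coef x : {set W} -> int := sval (cid (descx_span x)).

Definition mark H x : int :=
  \sum_(L : {set W} | L \subset S) (fixnum H L)%:Z * desc_coef x L.

Lemma markE H (c : {set W} -> int) :
  mark H (\sum_(L : {set W} | L \subset S) descx L *~ c L) =
  \sum_(L : {set W} | L \subset S) (fixnum H L)%:Z * c L.
Proof.
rewrite /mark; move Ex: (\sum_(L | _) descx L *~ _) => x.
have xb := svalP (cid (descx_span x)); rewrite -/(desc_coef x) in xb.
apply: eq_bigr => L LS; congr (_ * _); apply/eqP; rewrite -subr_eq0; apply/eqP.
apply: (descx_free (c := fun L => desc_coef x L - c L)) => //.
under eq_bigr => M _ do rewrite mulrzBr.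
by rewrite sumrB -xb Ex subrr.
Qed.

Fact mark_zmod_morphism H : zmod_morphism (mark H).
Proof.
move=> x y; have [[a ->] [b ->]] := (descx_span x, descx_span y).
rewrite -sumrB; under eq_bigr => L _ do rewrite -mulrzBr.
by rewrite !markE -sumrB; apply: eq_bigr => L _; rewrite mulrBr.
Qed.
HB.instance Definition _ H :=
  GRing.isZmodMorphism.Build (descRing W) int (mark H) (mark_zmod_morphism H).

Lemma mark_descx H K : K \subset S -> mark H (descx K) = (fixnum H K)%:Z.
Proof.
move=> KS; transitivity (mark H (\sum_(L : {set W} | L \subset S) descx L *~ (L == K)%:Z)).
  by congr mark; rewrite (bigD1 K) //= eqxx big1 ?addr0 // => L /andP[_ /negPf->].
rewrite markE (bigD1 K) //= eqxx mulr1 big1 ?addr0 // => L /andP[_ /negPf->].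
by rewrite mulr0.
Qed.

Lemma descxM J K : J \subset S -> K \subset S ->
  descx J * descx K =
  \sum_(d | (d^-1 \in coxmin J)%g && (d \in coxmin K)) descx (K :&: J :^ d)%g
  :> descRing W.
Proof.
move=> JS KS; apply: val_inj; rewrite rmorphM raddf_sum /= !descxE // xsumM //.
by apply: eq_bigr => d _; rewrite descxE // (subset_trans (subsetIl _ _)).
Qed.

Lemma descx_gens : descx S = 1 :> descRing W.
Proof. by apply: val_inj; rewrite descxE // xsum_gens rmorph1. Qed.

Lemma fixnum_gens H : fixnum H S = 1%N.
Proof.
have [_ gS _] := cox_axiom W.
rewrite -(cards1 (1%g : W)); apply: eq_card => w.
by rewrite in_set coxmin_gens gS subsetT andbT inE.
Qed.

(** By bilinearity only products of basis elements matter, and there [descxM] and [fixnumM] are sums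
    over the same [d]. *)
Fact mark_monoid_morphism H : monoid_morphism (mark H).
Proof.
split=> [|x y]; first by rewrite -descx_gens mark_descx // fixnum_gens.
have [[a ->] [b ->]] := (descx_span x, descx_span y).
rewrite mulr_suml !raddf_sum /= mulr_suml; apply: eq_bigr => J JS.
rewrite !mulr_sumr raddf_sum; apply: eq_bigr => K KS.
rewrite mulrzAr mulrzAl !raddfMz /= mulrzAr mulrzAl !mark_descx //.
rewrite descxM // raddf_sum -PoszM fixnumM // /=.
congr (_ *~ _ *~ _); rewrite [RHS](big_morph Posz PoszD (erefl _)).
apply: eq_bigr => d _; rewrite mark_descx //.
exact: subset_trans (subsetIl _ _) KS.
Qed.
HB.instance Definition _ H :=
  GRing.isMonoidMorphism.Build (descRing W) int (mark H) (mark_monoid_morphism H).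

(** Both sides are [#|W|] times the sum of the coordinates of [x], since the identity lies in every
    [coxmin L]. *)
Lemma sum_mark x : (\sum_w mark [set w] x)%:~R = val x 1%g * #|W|%:R :> rat.
Proof.
have [c xE] := descx_span x; rewrite {1}xE.
under eq_bigr => w _ do rewrite markE.
rewrite exchange_big /=.
have -> : val x = \sum_(L : {set W} | L \subset S) xsum L *~ c L.
  by rewrite xE raddf_sum; apply: eq_bigr => L LS; rewrite raddfMz /= descxE.
rewrite xsum_combE -[X in _ = _ * X]mulrz_nat -intrM; congr _%:~R.
rewrite mulr_suml [RHS](eq_bigl (fun L => L \subset S)) => [|L].
  apply: eq_bigr => L LS; rewrite -mulr_suml mulrC -(sum_fixnum LS).
  by rewrite natr_sum; congr (_ * _); apply: eq_bigr => w _; rewrite natz.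
by rewrite coxmin1 andbT.
Qed.

Lemma mark_nilpotent x : (forall w, mark [set w] x = 0) -> exists k, x ^+ k = 0.
Proof.
move=> x0; have [k|k xk] := @groupAlg_nilpotent W (val x).
  move=> k0; have := sum_mark (x ^+ k); rewrite big1 => [|w _]; last first.
    by rewrite rmorphXn /= x0 expr0n gtn_eqF.
  rewrite rmorphXn /= => /esym/eqP; rewrite mulf_eq0 => /orP[/eqP//|].
  rewrite pnatr_eq0 -leqn0 leqNgt => /negP[].
  by apply/card_gt0P; exists 1%g.
by exists k; apply: val_inj; rewrite rmorphXn /= xk.
Qed.

(* Otherwise every conjugate of an element of <<J>> is a zero of some factor of
   y below, so that y is nilpotent, whereas mark <<J>> y is not zero. *)
Lemma generic_element J : J \subset S ->
  exists g, mark [set g] =1 mark <<J>>%g.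
Proof.
move=> JS; apply: contrapT => no_g; pose m K := fixnum <<J>>%g K.
(* A subset of [<<J>>] fixes at least as many cosets, so two different marks must differ by a strict
   increase somewhere. *)
have big_fix g : g \in <<J>>%g ->
    exists2 K : {set W}, K \subset S & (m K < fixnum [set g] K)%N.
  move=> gJ; apply: contrapT => no_K; apply: no_g; exists g => x.
  apply: eq_bigr => K KS; congr (_%:Z * _); apply/eqP.
  rewrite eqn_leq [X in _ && X]fixnum_sub ?sub1set // andbT leqNgt.
  by apply/negP=> ltK; apply: no_K; exists K.
(* The factor [descx J] kills the marks of elements not conjugate into [<<J>>]. The product kills
   those fixing more than [m K] cosets for some [K], yet does not vanish at [<<J>>], where the count
   is [m K]. *)
pose y := descx J * \prod_(K : {set W} | K \subset S)
  \prod_(i < #|W|.+1 | (m K < i)%N) (descx K - i%:R).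
have yE H : mark H y = (fixnum H J)%:Z * \prod_(K : {set W} | K \subset S)
    \prod_(i < #|W|.+1 | (m K < i)%N) ((fixnum H K)%:Z - i%:R).
  rewrite rmorphM /= mark_descx // rmorph_prod; congr (_ * _).
  apply: eq_bigr => K KS; rewrite rmorph_prod; apply: eq_bigr => i _.
  by rewrite rmorphB /= mark_descx // rmorph_nat.
have [k yk] : exists k, y ^+ k = 0.
  apply: mark_nilpotent => w; rewrite yE.
  have [->|] := eqVneq (fixnum [set w] J) 0%N; first by rewrite mul0r.
  rewrite -lt0n => /card_gt0P[u /setIdP[_]]; rewrite conjg_set1 sub1set.
  case/big_fix=> K KS; rewrite -conjg_set1 fixnumJ // => ltK.
  apply/eqP; rewrite mulf_eq0; apply/orP; right.
  apply/prodf_eq0; exists K => //; apply/prodf_eq0.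
  have lt_fW : (fixnum [set w] K < #|W|.+1)%N by rewrite ltnS fixnum_max.
  by exists (Ordinal lt_fW) => //=; rewrite natz subrr.
have := congr1 (mark <<J>>%g) yk; rewrite rmorphXn rmorph0 /=.
apply/eqP; rewrite expf_neq0 // yE mulf_neq0 //.
  by rewrite eqz_nat fixnum_norm // -lt0n indexg_gt0.
apply/prodf_neq0 => K KS; apply/prodf_neq0 => i lt_mi.
by rewrite subr_eq0 natz eqz_nat neq_ltn lt_mi.
Qed.

(** Filtering by cardinality refines the order by inclusion and allows induction on [n]. *)
Definition descfil n : {pred descRing W} := fun x =>
  `[< exists c : {set W} -> int,
        x = \sum_(L : {set W} | (L \subset S) && (#|L| < n)%N) descx L *~ c L >].

Lemma descfilP n x :
  reflect (exists c : {set W} -> int,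
    x = \sum_(L : {set W} | (L \subset S) && (#|L| < n)%N) descx L *~ c L)
    (x \in descfil n).
Proof. exact: asboolP. Qed.

Fact descfil_zmod n : zmod_closed (descfil n).
Proof.
split=> [|x y /descfilP[a ->] /descfilP[b ->]]; apply/descfilP.
  by exists (fun=> 0); rewrite big1 // => L _; rewrite mulr0z.
exists (fun L => a L - b L); rewrite -sumrB.
by apply: eq_bigr => L _; rewrite mulrzBr.
Qed.
HB.instance Definition _ n := GRing.isZmodClosed.Build _ (descfil n) (descfil_zmod n).

Lemma descx_fil n L : L \subset S -> (#|L| < n)%N -> descx L \in descfil n.
Proof.
move=> LS ltLn; apply/descfilP; exists (fun K => (K == L)%:Z).
rewrite (bigD1 L) /= ?LS // eqxx big1 ?addr0 // => K /andP[_ /negPf->].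
by rewrite mulr0z.
Qed.

Lemma descfil_leq m n : (m <= n)%N -> {subset descfil m <= descfil n}.
Proof.
move=> le_mn _ /descfilP[c ->]; apply: rpred_sum => L /andP[LS ltLm].
by rewrite rpredMz // descx_fil // (leq_trans ltLm).
Qed.

(* The coefficient of descx K in descx J * descx K is found by applying
   mark <<K>>, which kills descx L when L is proper in K. *)
Lemma descM_triangular x K : K \subset S ->
  x * descx K - descx K *~ mark <<K>>%g x \in descfil #|K|.
Proof.
move=> KS; have [c ->] := descx_span x.
rewrite mulr_suml (raddf_sum (mark _)) mulrz_sumr -sumrB; apply: rpred_sum => J JS.
rewrite (raddfMz (mark _)) /= mulrzAl mulrzz mulrzA -mulrzBl rpredMz // mark_descx //.
have splitM : descx J * descx K = descx K *+ #|[pred d |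
      ((d^-1 \in coxmin J)%g && (d \in coxmin K)) && (K \subset J :^ d)%g]| +
    \sum_(d | ((d^-1 \in coxmin J)%g && (d \in coxmin K)) && ~~ (K \subset J :^ d)%g)
      descx (K :&: J :^ d)%g :> descRing W.
  rewrite descxM // (bigID (fun d => K \subset J :^ d)%g) /= -sumr_const.
  by congr (_ + _); apply: eq_bigr => d /andP[_ /setIidPl->].
have KIJ d : ~~ (K \subset J :^ d)%g -> (K :&: J :^ d)%g \proper K.
  by move=> Kd; rewrite properEneq subsetIl andbT; apply: contraNneq Kd => /setIidPl.
have IS d : (K :&: J :^ d)%g \subset S by apply: subset_trans (subsetIl _ _) KS.
move: splitM; set n := #|_|; set E := \sum_(d | _) _ => splitM.
(* Both sides acquire the index of [<<K>>] in its normalizer as a factor; it is nonzero and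
   cancels. *)
have nE : n = fixnum <<K>>%g J.
  have := congr1 (mark <<K>>%g) splitM.
  rewrite rmorphM raddfD raddfMn /= !mark_descx // raddf_sum big1 => [|d].
    move/eqP; rewrite addr0 -mulr_natl natz -!PoszM eqz_nat eqn_pmul2r => [/eqP//|].
    by rewrite fixnum_norm // indexg_gt0.
  by case/andP=> _ /KIJ ltK; rewrite /= mark_descx // fixnum_proper.
rewrite splitM nE addrAC -pmulrn subrr add0r; apply: rpred_sum => d /andP[_ /KIJ ltK].
by rewrite descx_fil // proper_card.
Qed.
End Marks.

(** * Nil left ideals and linear spans *)

(** If a maximal left ideal [M] misses [a], then [1 = m + b * a] with [m] in [M]; but [1 - b * a] is
    inverted by a finite geometric series. *)
Lemma nil_jacobson_radical (A : nzRingType) (a : A) :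
  (forall b, exists n, (b * a) ^+ n = 0) -> jacobson_radical a.
Proof.
move=> nil M [[M0 MD MM] M1 maxM]; apply: contrapT => Ma.
pose I y := exists m b, M m /\ y = m + b * a.
have MI y : M y -> I y by exists y, 0; rewrite mul0r addr0.
have I1 : I 1.
  apply: contrapT => I1; apply/Ma/(maxM I) => //; last first.
    by exists 0, 1; rewrite mul1r add0r.
  split; first exact: MI.
    move=> _ _ [m [b [Mm ->]]] [m' [b' [Mm' ->]]]; exists (m + m'), (b + b').
    by rewrite mulrDl addrACA; split; first exact: MD.
  move=> c _ [m [b [Mm ->]]]; exists (c * m), (c * b).
  by rewrite mulrDr mulrA; split; first exact: MM.
have [m [b [Mm E1]]] := I1; have [n ban] := nil b; apply: M1.
have -> : 1 = (\sum_(i < n) (b * a) ^+ i) * m; last exact: MM.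
have -> : m = 1 - b * a by rewrite E1 addrK.
transitivity ((1 - b * a) * (\sum_(i < n) (b * a) ^+ i)).
  by apply: oppr_inj; rewrite -mulNr opprB -subrX1 ban add0r.
rewrite mulr_suml mulr_sumr; apply: eq_bigr => i _.
by rewrite mulrBl mulrBr mul1r mulr1 -exprS -exprSr.
Qed.

Section LinSpan.
Variables (F : nzRingType) (V : lmodType F) (X : V -> Prop).

Lemma lin_span_mem v : X v -> lin_span X v.
Proof.
by move=> Xv; exists 1%N, (fun=> 1), (fun=> v); rewrite big_ord1 scale1r.
Qed.

Lemma lin_span0 : lin_span X 0.
Proof. by exists 0%N, (fun=> 0), (fun=> 0); split=> [[]|]; rewrite ?big_ord0. Qed.

Lemma lin_spanD u v : lin_span X u -> lin_span X v -> lin_span X (u + v).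
Proof.
move=> [m [a [x [Xx ->]]]] [n [b [y [Xy ->]]]].
exists (m + n)%N, (fun i => match split i with inl j => a j | inr j => b j end).
exists (fun i => match split i with inl j => x j | inr j => y j end).
split=> [i|]; first by case: split.
rewrite big_split_ord; congr (_ + _); apply: eq_bigr => i _.
  by rewrite -/(unsplit (inl i)) unsplitK.
by rewrite -/(unsplit (inr i)) unsplitK.
Qed.

Lemma lin_spanZ c v : lin_span X v -> lin_span X (c *: v).
Proof.
move=> [n [a [x [Xx ->]]]]; exists n, (fun i => c * a i), x; split=> //.
by rewrite scaler_sumr; apply: eq_bigr => i _; rewrite scalerA.
Qed.

Lemma lin_spanMz v (m : int) : lin_span X v -> lin_span X (v *~ m).
Proof. by rewrite -scaler_int; apply: lin_spanZ. Qed.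

Lemma lin_span_sum (I : Type) (r : seq I) (P : pred I) (f : I -> V) :
  (forall i, P i -> lin_span X (f i)) -> lin_span X (\sum_(i <- r | P i) f i).
Proof. by move=> Xf; apply: big_ind; [apply: lin_span0 | apply: lin_spanD |]. Qed.

End LinSpan.

(** * Representatives of the conjugacy classes of subsets of [S] *)

Section SubsetConjugacy.
Variable W : finCoxeterSystem.
Local Notation S := (cox_gens W).
Implicit Types (K L M : {set W}).

Definition conj_repr L :=
  odflt L [pick K : {set W} | (K \subset S) && [exists w : W, L :^ w == K]%g].

Lemma conj_reprP L : L \subset S ->
  conj_repr L \subset S /\ exists w, (L :^ w)%g = conj_repr L.
Proof.
move=> LS; rewrite /conj_repr; case: pickP => [K /andP[KS /existsP[w /eqP Lw]]|no].
  by split=> //; exists w.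
by split=> //; exists 1%g; rewrite conjsg1.
Qed.

Lemma conj_repr_eq L M w : L \subset S -> M \subset S -> (L :^ w)%g = M ->
  conj_repr L = conj_repr M.
Proof.
move=> LS MS Lw; rewrite /conj_repr.
have <- : [pick K : {set W} | (K \subset S) && [exists w : W, L :^ w == K]%g] =
   [pick K : {set W} | (K \subset S) && [exists w : W, M :^ w == K]%g].
  apply: eq_pick => K /=; congr (_ && _); rewrite -Lw.
  apply/existsP/existsP=> -[u /eqP<-].
    by exists (w^-1 * u)%g; rewrite -conjsgM mulKVg.
  by exists (w * u)%g; rewrite conjsgM.
(* The defaults [L] and [M] may differ, but are not reached: [L] itself satisfies the predicate. *)
case: pickP => // /(_ L); rewrite LS /= => /negbT/negP[]; apply/existsP.
by exists 1%g; rewrite conjsg1.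
Qed.

End SubsetConjugacy.

(** * The map [phi], its kernel and the radical *)

Section ModularRadical.
Variables (W : finCoxeterSystem) (p : nat) (p_pr : prime p).
Local Notation S := (cox_gens W).
Local Notation A := (modDescAlg W p_pr).
Implicit Types (w : W) (K L M : {set W}) (x y : descRing W) (a b : A).

(** Modulo [p] the diagonal entries vanish, so left multiplication by [x] lowers the filtration
    [descfil] by one step. *)
Lemma mark_dvd_nilpotent x :
    (forall K, K \subset S -> (p %| mark <<K>>%g x)%Z) ->
  exists n, x ^+ n \in pmul p.
Proof.
move=> px; have fil n y : y \in descfil n -> x ^+ n * y \in pmul p.
  elim: n y => [|n IHn] y /descfilP[c ->].
    by rewrite big1 ?mulr0 ?rpred0 // => L; rewrite ltn0 andbF.
  rewrite mulr_sumr; apply: rpred_sum => L /andP[LS leLn].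
  rewrite mulrzAr rpredMz // exprSr -mulrA -[x * _](subrK (descx L *~ mark <<L>>%g x)).
  rewrite mulrDr rpredD //.
    by apply: IHn; apply: descfil_leq (descM_triangular x LS).
  have /dvdzP[m ->] := px L LS; apply/pmulP.
  by exists (x ^+ n * descx L *~ m); rewrite mulrzA mulrzAr mulrzAr.
(* The bound in [descfil] is strict, so [1 = descx S] first appears at level [#|S|.+1]. *)
exists #|S|.+1; rewrite -[_ ^+ _]mulr1 -descx_gens; apply: fil.
exact: descx_fil.
Qed.

Lemma Fp_intr_eq0 (m : int) : (m%:~R == 0 :> 'F_p) = (p %| m)%Z.
Proof. by rewrite (dvdz_pcharf (pchar_Fp p_pr)). Qed.

Lemma rho1P a : exists x, a = rho1 p_pr x.
Proof. exact: redP. Qed.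

(** Defined on a chosen representative; by [phiE] the choice does not matter modulo [p]. *)
Definition phi a : {ffun W -> ('F_p)^o} :=
  [ffun w => (mark [set w] (generic_quotient.repr a))%:~R].

Lemma phiE x w : phi (rho1 p_pr x) w = (mark [set w] x)%:~R.
Proof.
rewrite ffunE; apply/eqP; rewrite -subr_eq0 -rmorphB -rmorphB /= Fp_intr_eq0.
have /red_eqP/pmulP[y ->] : red p (generic_quotient.repr (rho1 p_pr x)) = red p x.
  by rewrite /red reprK.
by rewrite raddfMn -mulr_natr natz dvdz_mull.
Qed.

Fact phi_zmod_morphism : zmod_morphism phi.
Proof.
move=> a b; have [[x ->] [y ->]] := (rho1P a, rho1P b).
have -> : rho1 p_pr x - rho1 p_pr y = rho1 p_pr (x - y) by rewrite rmorphB.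
apply/ffunP=> w; have subE (f g : {ffun W -> ('F_p)^o}) : (f - g) w = f w - g w.
  by rewrite !ffunE.
by rewrite subE !phiE !rmorphB.
Qed.
HB.instance Definition _ :=
  GRing.isZmodMorphism.Build A {ffun W -> ('F_p)^o} phi phi_zmod_morphism.

Fact phi_monoid_morphism : monoid_morphism phi.
Proof.
split=> [|a b].
  have -> : 1 = rho1 p_pr (1 : descRing W) by rewrite rmorph1.
  apply/ffunP=> w; have -> : (1 : {ffun W -> ('F_p)^o}) w = 1 by rewrite ffunE.
  by rewrite phiE !rmorph1.
have [[x ->] [y ->]] := (rho1P a, rho1P b).
have -> : rho1 p_pr x * rho1 p_pr y = rho1 p_pr (x * y) by rewrite rmorphM.
apply/ffunP=> w; have mulE (f g : {ffun W -> ('F_p)^o}) : (f * g) w = f w * g w.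
  by rewrite ffunE.
by rewrite mulE !phiE !rmorphM.
Qed.
HB.instance Definition _ :=
  GRing.isMonoidMorphism.Build A {ffun W -> ('F_p)^o} phi phi_monoid_morphism.

Fact phi_scalable : scalable phi.
Proof.
move=> c a; have -> : c *: a = a *+ c by rewrite -mulr_natl.
rewrite raddfMn /= -scaler_nat.
by congr (_ *: _); apply: natr_Zp.
Qed.
HB.instance Definition _ :=
  GRing.isScalable.Build 'F_p A {ffun W -> ('F_p)^o} *:%R phi phi_scalable.

Lemma phi_eq0P x : phi (rho1 p_pr x) = 0 <-> forall w, (p %| mark [set w] x)%Z.
Proof.
split=> [/ffunP x0 w|x0]; first by rewrite -Fp_intr_eq0 -phiE x0 ffunE.
by apply/ffunP=> w; rewrite phiE ffunE; apply/eqP; rewrite Fp_intr_eq0.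
Qed.

Lemma phi_xbar K : K \subset S -> phi (xbar p_pr K) = rho2 p (permchar K).
Proof.
by move=> KS; apply/ffunP=> w; rewrite phiE mark_descx // ffunE permchar_fixnum.
Qed.

Lemma modPermchar_phi a : modPermchar (phi a).
Proof.
have [x ->] := rho1P a; have [c ->] := descx_span x.
exists (\sum_(K : {set W} | K \subset S) permchar K *~ c K); first by exists c.
apply/ffunP=> w; rewrite phiE markE ffunE; congr (_%:~R).
rewrite sum_ffunE; apply: eq_bigr => K KS.
have -> (f : {ffun W -> int}) (n : int) : (f *~ n) w = f w * n.
  by rewrite -mulrzz; case: n => n; rewrite ?NegzE ?mulrNz ?ffunE ffunMnE.
by rewrite permchar_fixnum.
Qed.

(** All [b * a] stay in the kernel, and generic elements carry divisibility by [p] from the marks of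
    elements to those of all [<<K>>], whence nilpotency. *)
Lemma ker_phi_rad a : phi a = 0 -> jacobson_radical a.
Proof.
move=> a0; apply: nil_jacobson_radical => b.
have : phi (b * a) = 0 by rewrite rmorphM /= a0 mulr0.
have [x ->] := rho1P (b * a) => /phi_eq0P x0.
have [n /pmulP[y xn]] : exists n, x ^+ n \in pmul p.
  apply: mark_dvd_nilpotent => K KS.
  by have [g <-] := generic_element KS.
exists n; rewrite -rmorphXn xn rmorphMn /= -mulr_natr.
by rewrite (pcharf0 (modDescRing_pchar W p_pr)) mulr0.
Qed.

Lemma rad_ker_phi a : jacobson_radical a -> phi a = 0.
Proof.
move=> rad; apply/ffunP=> w; rewrite [RHS]ffunE.
have phi0 (f g : {ffun W -> ('F_p)^o}) : (f + g) w = f w + g w by rewrite ffunE.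
have mulE (f g : {ffun W -> ('F_p)^o}) : (f * g) w = f w * g w by rewrite ffunE.
(* Evaluation at [w] maps onto the field ['F_p], so its kernel is a maximal left ideal. *)
apply: (rad (fun a => phi a w = 0)); split.
- split=> [|x y x0 y0|b x x0]; first by rewrite raddf0 ffunE.
    by rewrite raddfD phi0 x0 y0 addr0.
  by rewrite rmorphM mulE x0 mulr0.
- by rewrite rmorph1 ffunE => /eqP; rewrite oner_eq0.
move=> I [I0 ID IM] subI I1 x Ix; apply: contrapT => /eqP nz; apply: I1.
have -> : 1 = (1 - (phi x w)^-1 *: x) + (phi x w)^-1 *: x by rewrite subrK.
apply: ID; last by rewrite -mulr_algl; apply: IM.
apply: subI; have -> : phi (1 - (phi x w)^-1 *: x) = 1 - (phi x w)^-1 *: phi x.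
  by rewrite linearB linearZ /=; congr (_ - _); apply: (rmorph1 phi).
have one1 : (1 : {ffun W -> ('F_p)^o}) w = 1 by rewrite ffunE.
rewrite -scaleNr phi0 one1.
have scaleE c (f : {ffun W -> ('F_p)^o}) : (c *: f) w = c * f w by rewrite ffunE.
by rewrite scaleE mulNr mulVf // subrr.
Qed.

Definition rad_gens b :=
  (exists J K : {set W}, [/\ J \subset S, K \subset S,
     (exists w : W, (J :^ w)%g = K) & b = xbar p_pr J - xbar p_pr K])
  \/ (exists J : {set W}, [/\ J \subset S,
     (p %| #|'N(<<J>>) : <<J>>|%g)%N & b = xbar p_pr J]).

Lemma rad_gens_ker b : rad_gens b -> phi b = 0.
Proof.
case=> [[J [K [JS KS [w JK] ->]]]|[J [JS pJ ->]]].
  rewrite -rmorphB; apply/phi_eq0P => v.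
  by rewrite rmorphB /= !mark_descx // (fixnum_conj [set v] JS KS JK) subrr dvdz0.
apply/phi_eq0P => v; rewrite mark_descx //.
exact: dvdn_trans pJ (norm_dvd_fixnum _ JS).
Qed.

Lemma span_ker_phi a : lin_span rad_gens a -> phi a = 0.
Proof.
move=> [n [c [u [gu ->]]]]; rewrite linear_sum big1 // => i _.
by rewrite linearZ /= rad_gens_ker ?scaler0.
Qed.

Lemma xbarMz_eq0 K (m : int) : (p %| m)%Z -> xbar p_pr K *~ m = 0.
Proof. by rewrite -Fp_intr_eq0 -scaler_int => /eqP->; rewrite scale0r. Qed.

(** Differences of conjugate subsets reduce [a] to a combination of class representatives [K] with
    coefficients [d K]; those with [d K] nonzero modulo [p] must have index divisible by [p]. *)
Lemma ker_phi_span a : phi a = 0 -> lin_span rad_gens a.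
Proof.
have [x ->] := rho1P a; have [c ->] := descx_span x.
pose r := @conj_repr W.
have -> : rho1 p_pr (\sum_(L : {set W} | L \subset S) descx L *~ c L) =
    \sum_(L : {set W} | L \subset S) (xbar p_pr L - xbar p_pr (r L)) *~ c L +
    \sum_(L : {set W} | L \subset S) xbar p_pr (r L) *~ c L.
  rewrite raddf_sum -big_split; apply: eq_bigr => L _ /=.
  by rewrite raddfMz mulrzBl subrK.
have span1 : lin_span rad_gens
    (\sum_(L : {set W} | L \subset S) (xbar p_pr L - xbar p_pr (r L)) *~ c L).
  apply: lin_span_sum => L LS; apply/lin_spanMz/lin_span_mem; left.
  by have [rS rL] := conj_reprP LS; exists L, (r L).
rewrite raddfD /= (span_ker_phi span1) add0r => phi0; apply: lin_spanD => //.
pose d K : int := \sum_(L : {set W} | (L \subset S) && (r L == K)) c L.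
have Ed : \sum_(L : {set W} | L \subset S) xbar p_pr (r L) *~ c L =
    \sum_(K : {set W} | K \subset S) xbar p_pr K *~ d K.
  rewrite (partition_big r (fun K : {set W} => K \subset S)) /= => [|L LS].
    apply: eq_bigr => K KS; rewrite mulrz_sumr; apply: eq_bigr => L /andP[_ /eqP<-//].
  by have [] := conj_reprP LS.
rewrite {}Ed in phi0 *.
have dP K : ~~ (p %| d K)%Z -> r K = K.
  apply: contraNeq => rK; rewrite /d big_pred0 ?dvdz0 // => L.
  apply/andP=> -[LS /eqP rL]; case/eqP: rK.
  have [rS [w Lw]] := conj_reprP LS; rewrite -/(r L) rL in rS Lw.
  by rewrite -{2}rL; symmetry; apply: conj_repr_eq LS rS Lw.
pose bad := [pred K : {set W} | [&& K \subset S, ~~ (p %| d K)%Z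
              & ~~ (p %| #|'N(<<K>>) : <<K>>|%g)%N]].
have [K0 badK0|no_bad] := pickP bad; last first.
  apply: lin_span_sum => K KS; have := no_bad K; rewrite /= KS /=.
  have [pd _|_ /=] := boolP (p %| d K)%Z.
    by rewrite xbarMz_eq0 //; apply: lin_span0.
  move/negbFE => pK; apply/lin_spanMz/lin_span_mem; right.
  by exists K.
(* A [bad] subset of largest size is contradicted by evaluating at a generic element of [<<K>>]. *)
have [K /and3P[KS pd pK] maxK] := arg_maxnP (fun K : {set W} => #|K|) badK0.
move: phi0.
have -> : \sum_(K : {set W} | K \subset S) xbar p_pr K *~ d K =
   rho1 p_pr (\sum_(K : {set W} | K \subset S) descx K *~ d K).
  by rewrite raddf_sum; apply: eq_bigr => L _; rewrite raddfMz.
move/phi_eq0P; have [g gK] := generic_element KS; move/(_ g).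
(* Every other term vanishes modulo [p]: otherwise [M] is [bad] and some conjugate of it contains
   [K], so by maximality [M] and [K] are conjugate representatives, hence equal. *)
rewrite gK markE (bigD1 K) //= rpredDr; last first.
  apply: rpred_sum => M /andP[MS neMK].
  have [pM|pM] := boolP (p %| d M)%Z; first exact: dvdz_mull.
  have [pN|pN] := boolP (p %| #|'N(<<M>>) : <<M>>|%g)%N.
    apply: dvdz_mulr; exact: dvdn_trans pN (norm_dvd_fixnum _ MS).
  have [->|/(fixnum_gen_neq0 MS KS)[w KMw]] := eqVneq (fixnum <<K>>%g M) 0%N.
    by rewrite mul0r dvdz0.
  have leMK : (#|M| <= #|K|)%N by apply: maxK; rewrite /= MS pM.
  have EK : (M :^ w)%g = K.
    by apply/esym/eqP; rewrite eqEcard KMw cardJg.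
  case/eqP: neMK; rewrite -(dP M pM) -(dP K pd).
  exact: conj_repr_eq EK.
rewrite fixnum_norm // dvdzE abszM Euclid_dvdM //= (negPf pK) /=.
by rewrite dvdzE in pd; rewrite (negPf pd).
Qed.

End ModularRadical.

Theorem theorem4 (W : finCoxeterSystem) (p : nat) (p_pr : prime p) :
  exists phi : {lrmorphism modDescAlg W p_pr -> {ffun W -> ('F_p)^o}},
  [/\ forall a, modPermchar (phi a),
      forall K : {set W}, K \subset cox_gens W ->
        phi (xbar p_pr K) = rho2 p (permchar K),
      forall a, jacobson_radical a <-> phi a = 0
    & forall a, jacobson_radical a <->
        lin_span (fun b =>
          (exists J K : {set W}, [/\ J \subset cox_gens W, K \subset cox_gens W,
             (exists w : W, (J :^ w)%g = K) & b = xbar p_pr J - xbar p_pr K])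
          \/ (exists J : {set W}, [/\ J \subset cox_gens W,
             (p %| #|'N(<<J>>) : <<J>>|%g)%N & b = xbar p_pr J])) a].
Proof.
exists (@phi W p p_pr); split=> [|||a].
- exact: modPermchar_phi.
- exact: phi_xbar.
- by move=> a; split; [apply: rad_ker_phi | apply: ker_phi_rad].
split=> [/rad_ker_phi/ker_phi_span//|ga].
apply: ker_phi_rad; exact: span_ker_phi ga.
Qed.
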